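(* For every $\star\in\{\mathrm{vvv},\mathrm{ev},\mathrm{ee}\}$ we have $\Lambda_\star^{\mathrm{pal}}\subseteq\Pi^{(3)}_{\star,\infty}$. That is, for every palette $\mathscr{P}$ there is a family $\mathcal{F}$ of $3$-graphs with $\pi_\star(\mathcal{F})=\Lambda^\star_{\mathscr{P}}$.
   Context: A $3$-graph $H=(V,E)$ consists of a finite vertex set $V$ and an edge set $E\subseteq V^{(3)}$, where $V^{(k)}=\{e\subseteq V : |e|=k\}$; we write $xy$, $xyz$ for $\{x,y\}$, $\{x,y,z\}$. A family of $3$-graphs is a (possibly infinite) set of $3$-graphs; $H$ is $\mathcal{F}$-free if it contains no member of $\mathcal{F}$ as a (not necessarily induced) subhypergraph. Densities. Let $H=(V,E)$ be a $3$-graph, $d\in[0,1]$, $\eta>0$. For $X,Y,Z\subseteq V$ and $P,Q\subseteq V^{(2)}$ let - $e_{\mathrm{vvv}}(X,Y,Z)=|\{(x,y,z)\in X\times Y\times Z : xyz\in E\}|$; - $e_{\mathrm{ev}}(X,P)=|\{(x,yz) : x\in X,\ yz\in P,\ xyz\in E\}|$, where each unordered pair $yz\in P$ is counted once; - $K_{\mathrm{ee}}(P,Q)=\{(x,y,z)\in V^3 : xy\in P,\ yz\in Q\}$ and $e_{\mathrm{ee}}(P,Q)=|\{(x,y,z)\in K_{\mathrm{ee}}(P,Q) : xyz\in E\}|$. $H$ is $(d,\eta,\mathrm{vvv})$-dense if $e_{\mathrm{vvv}}(X,Y,Z)\geq d|X||Y||Z|-\eta|V|^3$ for all $X,Y,Z\subseteq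 V$; it is $(d,\eta,\mathrm{ev})$-dense if $e_{\mathrm{ev}}(X,P)\geq d|X||P|-\eta|V|^3$ for all $X\subseteq V$, $P\subseteq V^{(2)}$; it is $(d,\eta,\mathrm{ee})$-dense if $e_{\mathrm{ee}}(P,Q)\geq d|K_{\mathrm{ee}}(P,Q)|-\eta|V|^3$ for all $P,Q\subseteq V^{(2)}$. For $\star\in\{\mathrm{vvv},\mathrm{ev},\mathrm{ee}\}$ and a family $\mathcal{F}$ of $3$-graphs, $\pi_\star(\mathcal{F})$ is the supremum of all $d\in[0,1]$ such that for all $\eta>0$ and $n\in\mathbb{N}$ there is an $\mathcal{F}$-free, $(d,\eta,\star)$-dense $3$-graph on at least $n$ vertices. Set $\Pi^{(3)}_{\star,\infty}=\{\pi_\star(\mathcal{F}) : \mathcal{F}\text{ is a family of }3\text{-graphs}\}$. Palettes. A palette is a nonempty finite set $\mathscr{P}$ of ordered triples of elements of $\mathbb{N}$ (entries may coincide). Its set of colours $\Phi(\mathscr{P})$ is the set of all entries of triples in $\mathscr{P}$. Let $\mathbb{S}_{|\Phi(\mathscr{P})|}$ be the set of vectors $\mathbf{x}=(x_a)_{a\in\Phi(\mathscr{P})}\in[0,1]^{\Phi(\mathscr{P})}$ with $\sum_a x_a=1$. For such $\mathbf{x}$ and $a,b\in\Phi(\mathscr{P})$ (not necessarily distinct) define $$\lambda^{\mathrm{vvv}}_{\mathscr{P}}(\mathbf{x})=\sum_{(a,b,c)\in\mathscr{P}}x_ax_bx_c,$$ $$\lambda^{a}_{\mathscr{P}}(\mathbf{x})=\min\Big\{\sum_{(a,c,d)\in\mathscr{P}}x_cx_d,\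 \sum_{(c,a,d)\in\mathscr{P}}x_cx_d,\ \sum_{(c,d,a)\in\mathscr{P}}x_cx_d\Big\},$$ $$\lambda^{a,b}_{\mathscr{P}}(\mathbf{x})=\min\Big\{\sum_{(a,b,c)\in\mathscr{P}}x_c,\ \sum_{(b,a,c)\in\mathscr{P}}x_c,\ \sum_{(a,c,b)\in\mathscr{P}}x_c,\ \sum_{(b,c,a)\in\mathscr{P}}x_c,\ \sum_{(c,a,b)\in\mathscr{P}}x_c,\ \sum_{(c,b,a)\in\mathscr{P}}x_c\Big\},$$ where in the last two displays $a$ (respectively $a,b$) is fixed and the sums run over the remaining colours. Put $$\lambda^{\mathrm{ev}}_{\mathscr{P}}(\mathbf{x})=\min_{a\in\Phi(\mathscr{P}):\,x_a>0}\lambda^a_{\mathscr{P}}(\mathbf{x}),\qquad \lambda^{\mathrm{ee}}_{\mathscr{P}}(\mathbf{x})=\min_{a,b\in\Phi(\mathscr{P}):\,x_ax_b>0}\lambda^{a,b}_{\mathscr{P}}(\mathbf{x}),$$ and for $\star\in\{\mathrm{vvv},\mathrm{ev},\mathrm{ee}\}$ let $\Lambda^\star_{\mathscr{P}}=\max_{\mathbf{x}\in\mathbb{S}_{|\Phi(\mathscr{P})|}}\lambda^\star_{\mathscr{P}}(\mathbf{x})$ be the $\star$-Lagrangian of $\mathscr{P}$. Set $\Lambda^{\mathrm{pal}}_\star=\{\Lambda^\star_{\mathscr{P}} : \mathscr{P}\text{ is a palette}\}$. *)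

(* Defs.v *)
From mathcomp Require Import all_boot all_order all_algebra finmap.
From mathcomp Require Import all_classical all_reals.
From mathcomp Require Import topology normedtype function_spaces.

Set Implicit Arguments.
Unset Strict Implicit.
Unset Printing Implicit Defensive.

Import Order.TTheory GRing.Theory Num.Theory.
Import numFieldNormedType.Exports.
Local Open Scope ring_scope.

Record graph3 := Graph3 {
  vertex : finType;
  edges : {set {set vertex}};
  card_edge : forall e, e \in edges -> #|e| = 3%N }.

Definition family := graph3 -> Prop.

Definition subhypergraph (G H : graph3) : Prop :=
  exists2 f : vertex G -> vertex H,
    injective f & forall e, e \in edges G -> f @: e \in edges H.

Definition family_free (F : family) (H : graph3) : Prop :=
  forall G, F G -> ~ subhypergraph G H.

Section Counting.
Variable H : graph3.
Local Notation V := (vertex H).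

Definition pairs : {set {set V}} := [set p : {set V} | #|p| == 2%N].

(* Members of [edges H] have exactly three elements, so the membership tests
   below force x, y, z to be pairwise distinct. *)
Definition e_vvv (X Y Z : {set V}) : nat :=
  #|[set t : V * V * V | let: (x, y, z) := t in
     [&& x \in X, y \in Y, z \in Z & [set x; y; z] \in edges H]]|.

Definition e_ev (X : {set V}) (P : {set {set V}}) : nat :=
  #|[set t : V * {set V} | let: (x, p) := t in
     [&& x \in X, p \in P & x |: p \in edges H]]|.

Definition K_ee (P Q : {set {set V}}) : {set V * V * V} :=
  [set t | let: (x, y, z) := t in ([set x; y] \in P) && ([set y; z] \in Q)].

Definition e_ee (P Q : {set {set V}}) : nat :=
  #|[set t in K_ee P Q | let: (x, y, z) := t in [set x; y; z] \in edges H]|.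

End Counting.

Local Open Scope classical_set_scope.

Inductive density_kind := vvv | ev | ee.

Definition uniformly_dense (R : realType) (star : density_kind) (d eta : R)
    (H : graph3) : Prop :=
  let err := eta * #|vertex H|%:R ^+ 3 in
  match star with
  | vvv => forall X Y Z : {set vertex H},
      d * #|X|%:R * #|Y|%:R * #|Z|%:R - err <= (e_vvv X Y Z)%:R
  | ev => forall (X : {set vertex H}) (P : {set {set vertex H}}),
      P \subset pairs H ->
      d * #|X|%:R * #|P|%:R - err <= (e_ev X P)%:R
  | ee => forall P Q : {set {set vertex H}},
      P \subset pairs H -> Q \subset pairs H ->
      d * #|K_ee P Q|%:R - err <= (e_ee P Q)%:R
  end.

(* If no d is admissible (e.g. if F contains the one-vertex graph), the
   supremum, taken within [0, 1], is 0; this is the value of [sup set0]. *)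
Definition turan_density (R : realType) (star : density_kind) (F : family)
    : R :=
  sup [set d : R | 0 <= d <= 1 /\
    forall (eta : R) (n : nat), 0 < eta ->
      exists H : graph3,
        [/\ (n <= #|vertex H|)%N, family_free F H
          & uniformly_dense star d eta H]].

Definition Pi_infty (R : realType) (star : density_kind) : set R :=
  [set r | exists F : family, turan_density R star F = r].

Record palette := Palette {
  triples : {fset nat * nat * nat};
  triples_neq0 : triples != fset0 }.

Definition colours (P : palette) : {fset nat} :=
  ([fset t.1.1 | t in triples P] `|` [fset t.1.2 | t in triples P]
    `|` [fset t.2 | t in triples P])%fset.

Section Lagrangian.
Variables (R : realType) (P : palette).
Local Notation Phi := (colours P).

Definition in_palette (a b c : Phi) : bool :=
  (val a, val b, val c) \in triples P.

Definition simplex : set (Phi -> R) :=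
  [set x | (forall a, 0 <= x a <= 1) /\ \sum_a x a = 1].

Implicit Types (x : Phi -> R) (a b c d : Phi).

Definition lambda_vvv x : R :=
  \sum_a \sum_b \sum_(c | in_palette a b c) x a * x b * x c.

Definition lambda_colour x a : R :=
  Num.min (\sum_c \sum_(d | in_palette a c d) x c * x d)
 (Num.min (\sum_c \sum_(d | in_palette c a d) x c * x d)
          (\sum_c \sum_(d | in_palette c d a) x c * x d)).

Definition lambda_pair x a b : R :=
  Num.min (\sum_(c | in_palette a b c) x c)
 (Num.min (\sum_(c | in_palette b a c) x c)
 (Num.min (\sum_(c | in_palette a c b) x c)
 (Num.min (\sum_(c | in_palette b c a) x c)
 (Num.min (\sum_(c | in_palette c a b) x c)
          (\sum_(c | in_palette c b a) x c))))).

(* On the simplex the sets below are finite and nonempty, so these infima are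
   minima. *)
Definition lambda_ev x : R :=
  inf [set lambda_colour x a | a in [set a | 0 < x a]].

Definition lambda_ee x : R :=
  inf [set lambda_pair x ab.1 ab.2 | ab in [set ab | 0 < x ab.1 * x ab.2]].

Definition lambda (star : density_kind) : (Phi -> R) -> R :=
  match star with
  | vvv => lambda_vvv
  | ev => lambda_ev
  | ee => lambda_ee
  end.

(* This supremum is a maximum, see [lagrangian_max] below. *)
Definition lagrangian (star : density_kind) : R :=
  sup [set lambda star x | x in simplex].

End Lagrangian.

(* The simplex is compact in the product topology, and each [lambda star] is
   upper semicontinuous on it: in a limit the constraints 0 < x a can only
   disappear. *)
Section LagrangianMax.
Variables (R : realType).

Lemma usc_max (T : topologicalType) (K : set T) (f : T -> R) (g : R -> set T) :
  compact K -> K !=set0 -> (forall t, closed (g t)) ->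
  (forall t x, K x -> t <= f x <-> g t x) ->
  exists2 x, K x & forall y, K y -> f y <= f x.
Proof.
move=> Kc [x0 Kx0] gc gP.
pose B y := [set x | K x /\ f y <= f x].
have PF : ProperFilter (filter_from K B).
  apply: filter_from_proper => [|y Ky]; last by exists y; split.
  apply: filter_from_filter; first by exists x0.
  move=> y z Ky Kz; have [yz|/ltW zy] := leP (f y) (f z).
    by exists z => // x [Kx zx]; split; split=> //; exact: le_trans zx.
  by exists y => // x [Kx yx]; split; split=> //; exact: le_trans yx.
have [|x [Kx clx]] := Kc (filter_from K B) _.
  by exists x0 => // x [].
exists x => // y Ky; apply/gP => //; apply: gc => U Ux.
apply: clx => //; exists y => // z [Kz yz]; exact/gP.
Qed.

Variable P : palette.
Local Notation Phi := (colours P).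
Local Notation T := (prod_topology (fun _ : Phi => R)).

Lemma ccoord (a : Phi) : continuous (fun x : T => x a : R).
Proof. exact: (@proj_continuous Phi (fun _ => R) a). Qed.

Lemma csum (I : finType) (Q : pred I) (f : I -> T -> R) :
  (forall i, Q i -> continuous (f i)) ->
  continuous (fun x => \sum_(i | Q i) f i x).
Proof. by move=> H; apply: continuous_big => // ; exact: add_continuous. Qed.

Lemma cmul (f g : T -> R) : continuous f -> continuous g ->
  continuous (fun x => f x * g x).
Proof.
move=> hf hg x.
exact: (@cvgM R T (nbhs x) _ f g (f x) (g x) (hf x) (hg x)).
Qed.

Lemma clge (f : T -> R) t : continuous f -> closed [set x | t <= f x].
Proof.
move=> hf; have := @closed_ge R t; move=> h.
by apply: (@preimage_closed T R f) h => // x _; exact: hf.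
Qed.

Lemma clle (f : T -> R) t : continuous f -> closed [set x | f x <= t].
Proof.
move=> hf; have := @closed_le R t; move=> h.
by apply: (@preimage_closed T R f) h => // x _; exact: hf.
Qed.

Lemma cleq (f : T -> R) t : continuous f -> closed [set x | f x = t].
Proof.
move=> hf; have := @closed_eq R t; move=> h.
by apply: (@preimage_closed T R f) h => // x _; exact: hf.
Qed.

Lemma closed_min (f g : T -> R) : 
  (forall t, closed [set x | t <= f x]) ->
  (forall t, closed [set x | t <= g x]) ->
  forall t, closed [set x | t <= Num.min (f x) (g x)].
Proof.
move=> hf hg t.
rewrite (_ : [set _ | _] = [set x | t <= f x] `&` [set x | t <= g x]);
  first exact: closedI.
by apply/seteqP; split => x /=; rewrite le_min => /andP.
Qed.

Lemma closed_all (I : finType) (p f : I -> T -> R) t :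
  (forall i, continuous (p i)) -> (forall i t, closed [set x | t <= f i x]) ->
  closed [set x | forall i, 0 < p i x -> t <= f i x].
Proof.
move=> hp hf.
rewrite (_ : [set _ | _] = \bigcap_(i in setT)
    ([set x | p i x <= 0] `|` [set x | t <= f i x])).
  apply: closed_bigI => i _; apply: closedU; [exact: clle|exact: hf].
apply/seteqP; split => x /=.
  by move=> H i _; have [?|/H] := leP (p i x) 0; [left|right].
by move=> H i pi; case: (H i Logic.I) => //=; rewrite leNgt pi.
Qed.

Lemma lagrangian_max star : exists x : Phi -> R,
  [/\ simplex x, lambda star x = lagrangian R P star
    & forall y : Phi -> R, simplex y -> lambda star y <= lambda star x].
Proof.
have cP : exists a0 : Phi, true.
  case: P => t t0; have [[[a b] c] tP] := fset0Pn _ t0.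
  have h : a \in colours (Palette t0).
    by rewrite /colours !inE; apply/orP; left; apply/orP; left;
      apply/imfsetP; exists (a, b, c).
  by exists [` h]%fset.
case: cP => a0 _.
have Kc : compact (@simplex R P : set T).
  rewrite (_ : @simplex R P = [set f : T | forall i, (`[0, 1]%classic : set R) (f i)]
      `&` [set x : T | \sum_a x a = 1]).
    apply: compact_closedI.
      by apply: (@tychonoff Phi (fun=> R) (fun=> `[0, 1]%classic)) => i;
        exact: segment_compact.
    by apply: cleq; apply: csum => i _; exact: ccoord.
  by apply/seteqP; split => x /= [H1 H2]; split=> // a;
    have := H1 a; rewrite /= in_itv.
have K0 : (@simplex R P : set T) !=set0.
  exists (fun a => (a == a0)%:R); split.
    by move=> a; case: eqP => _; rewrite ?lexx ?ler01.
  by rewrite (bigD1 a0) //= eqxx big1 ?addr0 // => i /negPf->.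
suff [g gc gP] : exists2 g : R -> set T, (forall t, closed (g t)) &
   forall t x, simplex x -> t <= lambda star x <-> g t x.
  have [x Kx Hx] := @usc_max _ _ _ _ Kc K0 gc gP.
  exists x; split=> //; apply/eqP; rewrite eq_le; apply/andP; split.
    by apply: ub_le_sup; [exists (lambda star x) => _ [y Ky <-];
      exact: Hx|exists x].
  by apply: ge_sup; [exists (lambda star x), x|move=> _ [y Ky <-]; exact: Hx].
have le_infP (I : finType) (A : set I) (f : I -> R) t : A !=set0 ->
    t <= inf [set f a | a in A] <-> forall a, A a -> t <= f a.
  move=> [i Ai]; split=> [H a Aa|H].
    apply: le_trans H _; apply: ge_inf; last by exists a.
    exists (- \sum_i `|f i|) => _ [b Ab <-].
    rewrite lerNl (bigD1 b) //= -normrN.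
    apply: le_trans (ler_norm _) _; rewrite lerDl sumr_ge0 //.
  by apply: lb_le_inf; [exists (f i), i|move=> _ [a Aa <-]; exact: H].
have pos x : simplex x -> exists a : Phi, 0 < x a.
  move=> [H1 H2]; apply: contrapT => /forallNP H.
  have: \sum_a x a = 0.
    apply: big1 => a _; apply/eqP; rewrite eq_le; have /andP[-> _] := H1 a.
    by rewrite andbT leNgt; apply/negP; exact: H.
  by move=> e; move: H2; rewrite e => /eqP; rewrite eq_sym oner_eq0.
case: star => /=.
- exists (fun t => [set x : T | t <= lambda_vvv x]) => // t.
  apply: clge; apply: csum => a _; apply: csum => b _; apply: csum => c _.
  by apply: cmul; [apply: cmul|]; exact: ccoord.
- exists (fun t => [set x : T | forall a, 0 < x a -> t <= lambda_colour x a]).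
    move=> t; apply: (@closed_all _ (fun a (x : T) => x a)
      (fun a x => lambda_colour x a)).
      by move=> i; exact: ccoord.
    move=> a {}t; apply: closed_min => {}t; [|apply: closed_min => {}t];
      apply: clge; apply: csum => c _; apply: csum => d _; apply: cmul; exact: ccoord.
  by move=> t x Kx; apply: le_infP; exact: pos.
- exists (fun t => [set x : T | forall ab : Phi * Phi,
    0 < x ab.1 * x ab.2 -> t <= lambda_pair x ab.1 ab.2]).
    move=> t; apply: (@closed_all (Phi * Phi)%type
      (fun ab (x : T) => x ab.1 * x ab.2)
      (fun ab x => lambda_pair x ab.1 ab.2)).
      by move=> i; apply: cmul; exact: ccoord.
    by move=> a {}t; apply: closed_min => {}t;
      [|apply: closed_min => {}t; [|apply: closed_min => {}t;
      [|apply: closed_min => {}t; [|apply: closed_min => {}t]]]];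
      apply: clge; apply: csum => c _; exact: ccoord.
  move=> t x Kx; apply: le_infP; have [a xa] := pos _ _ Kx.
  by exists (a, a) => /=; rewrite mulr_gt0.
Qed.
End LagrangianMax.

Definition Lambda_pal (R : realType) (star : density_kind) : set R :=
  [set r | exists P : palette, lagrangian R P star = r].

Arguments Pi_infty : clear implicits.
Arguments Lambda_pal : clear implicits.

(* Main.v *)
(* The 3-graphs admitting a linear order of the vertices and a symmetric
   colouring of the pairs such that the colours of every edge, read in
   increasing order, form a triple of the palette are closed under taking
   subhypergraphs; the family consists of all other 3-graphs.

   Upper bound. Energy-increment regularity applied to the colour classes,
   starting from a partition into intervals, followed by Ramsey's theorem on
   the rounded density vectors, yields in every large coloured ordered set three
   linearly sized sets A < B < C and a vector x of the simplex such that, for all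
   colours a, b, c, the triples with pair colours a, b, c have density close to
   x_a x_b x_c. Evaluating the density condition on these sets gives
   x_a d <= x_a lambda^a(x) + error for ev, and the analogous inequalities for
   vvv and ee. Multiplied by the weights, these inequalities are closed
   conditions, so that they hold without error at some x by compactness of the
   simplex.

   Lower bound. Colour the pairs of {0, ..., N-1} independently with an optimal
   weight vector x. Bounding the expected number of signed four-cycles gives a
   colouring whose colour classes deviate from their expectation by o(N^2) in
   the cut norm, and this alone controls the three densities: a sum over triples
   (u, v, z) in which the pair (u, v) is only weighted by its colour is, for
   fixed z, a sum over a product of two sets. *)
Require Import Defs.
From mathcomp Require Import all_classical all_reals.
From mathcomp Require Import topology normedtype function_spaces.
From mathcomp Require Import all_boot all_order all_algebra finmap.
From mathcomp Require Import ring lra zify.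

Set Implicit Arguments.
Unset Strict Implicit.
Unset Printing Implicit Defensive.

Import Order.TTheory GRing.Theory Num.Theory.
Import numFieldNormedType.Exports.
Local Open Scope ring_scope.

(** * Cut norm and triangle counts *)

Section Cut.
Variables (R : realDomainType) (V : finType).
Implicit Types (X Y Z S T : {set V}) (f g h u o : rel V) (w C : R).

(** The reference relation [o] keeps this general enough for both bounds: it is the complete
    relation for regular pairs and the order relation for random colourings. *)
Definition cut_close X Y f o w C : Prop :=
  forall S T, S \subset X -> T \subset Y ->
  `|\sum_(x in S) \sum_(y in T) ((f x y)%:R - w * (o x y)%:R)| <= C.

Lemma cut_close_tr X Y f o w C : cut_close X Y f o w C ->
  cut_close Y X (fun y x => f x y) (fun y x => o x y) w C.
Proof. by move=> H S T SY TX; rewrite exchange_big; apply: H. Qed.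

Definition tri X Y Z f g h : R :=
  \sum_(x in X) \sum_(y in Y) \sum_(z in Z)
     (f x y)%:R * (g y z)%:R * (h x z)%:R.

Lemma tri_rot X Y Z f g h :
  tri X Y Z f g h = tri Y Z X g (fun z x => h x z) (fun y x => f x y).
Proof.
rewrite /tri exchange_big; apply: eq_bigr => y _.
rewrite exchange_big; apply: eq_bigr => z _; apply: eq_bigr => x _.
by rewrite -mulrA mulrC.
Qed.

Lemma tri_flip X Y Z f g h :
  tri X Y Z f g h = tri Z Y X (fun z y => g y z) (fun y x => f x y)
    (fun z x => h x z).
Proof.
rewrite /tri; under eq_bigr do rewrite exchange_big.
rewrite exchange_big; apply: eq_bigr => z _.
rewrite exchange_big; apply: eq_bigr => y _; apply: eq_bigr => x _.
by congr (_ * _); rewrite mulrC.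
Qed.

(** For fixed [z], the factors [g y z] and [h x z] merely restrict [y] and [x] to two sets. The
    inner double sum is therefore a cut sum, at most [C], and there are [#|Z|] choices of [z]. *)
Lemma tri_swap1 X Y Z f g h o w C : cut_close X Y f o w C ->
  `|tri X Y Z f g h - w * tri X Y Z o g h| <= #|Z|%:R * C.
Proof.
move=> H.
pose S z := [set x in X | h x z]; pose T z := [set y in Y | g y z].
have -> : tri X Y Z f g h - w * tri X Y Z o g h =
  \sum_(z in Z) \sum_(x in S z) \sum_(y in T z)
    ((f x y)%:R - w * (o x y)%:R).
  have triE k : tri X Y Z k g h =
      \sum_(z in Z) \sum_(x in S z) \sum_(y in T z) (k x y)%:R.
    rewrite /tri; under eq_bigr do rewrite exchange_big.
    rewrite exchange_big; apply: eq_bigr => z _.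
    rewrite [RHS](eq_bigl (fun x => (x \in X) && h x z)); last first.
      by move=> x; rewrite inE.
    rewrite [RHS]big_mkcondr; apply: eq_bigr => x _; case: (h x z); last first.
      by rewrite big1 // => y _; rewrite mulr0.
    rewrite [RHS](eq_bigl (fun y => (y \in Y) && g y z)); last first.
      by move=> y; rewrite inE.
    rewrite [RHS]big_mkcondr; apply: eq_bigr => y _.
    by rewrite mulr1; case: (g y z); rewrite ?mulr1 ?mulr0.
  rewrite !triE mulr_sumr -sumrB; apply: eq_bigr => z _.
  rewrite mulr_sumr -sumrB; apply: eq_bigr => x _.
  by rewrite mulr_sumr -sumrB.
apply: le_trans (ler_norm_sum _ _ _) _.
rewrite -sum1_card natr_sum mulr_suml; apply: ler_sum => z _.
by rewrite mul1r; apply: H; apply/subsetP => v; rewrite inE => /andP[].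
Qed.

Lemma tri_swap2 X Y Z f g h o w C : cut_close Y Z g o w C ->
  `|tri X Y Z f g h - w * tri X Y Z f o h| <= #|X|%:R * C.
Proof. by move=> H; rewrite !(tri_rot X Y); apply: tri_swap1. Qed.

Lemma tri_swap3 X Y Z f g h o w C : cut_close X Z h o w C ->
  `|tri X Y Z f g h - w * tri X Y Z f g o| <= #|Y|%:R * C.
Proof.
move=> /cut_close_tr H; rewrite !(tri_rot X Y) !(tri_rot Y Z).
exact: tri_swap1 H.
Qed.

End Cut.

Section CutCount.
Variables (R : realDomainType) (V : finType).
Variables (X Y Z : {set V}) (f g h of' og oh : rel V) (wf wg wh Cf Cg Ch : R).
Hypothesis wf01 : 0 <= wf <= 1.
Hypothesis wh01 : 0 <= wh <= 1.
Hypothesis closef : cut_close X Y f of' wf Cf.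
Hypothesis closeh : cut_close X Z h oh wh Ch.

(** Lets replacements be chained: since [w] is at most 1, the error of the next replacement is not
    amplified and the errors simply add. *)
Lemma weight_swap (w a b c C D : R) : 0 <= w <= 1 ->
  `|a - w * b| <= C -> `|b - c| <= D -> `|a - w * c| <= C + D.
Proof.
move=> /andP[w0 w1] ab bc.
have -> : a - w * c = (a - w * b) + w * (b - c) by ring.
apply: le_trans (ler_normD _ _) (lerD ab _).
rewrite normrM (ger0_norm w0); apply: le_trans bc.
by rewrite ler_piMl.
Qed.

(** Here [g] stays as it is. This is the form for ev, where the pairs [y z] come from an arbitrary
    prescribed set and only the other two relations are random. *)
Lemma tri_count2 :
  `|tri R X Y Z f g h - wf * (wh * tri R X Y Z of' g oh)|
     <= #|Z|%:R * Cf + #|Y|%:R * Ch.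
Proof.
apply: (weight_swap wf01 (tri_swap1 Z g h closef)).
exact: tri_swap3.
Qed.

Hypothesis closeg : cut_close Y Z g og wg Cg.

Lemma tri_count3 :
  `|tri R X Y Z f g h - wf * (wh * (wg * tri R X Y Z of' og oh))|
     <= #|Z|%:R * Cf + (#|Y|%:R * Ch + #|X|%:R * Cg).
Proof.
apply: (weight_swap wf01 (tri_swap1 Z g h closef)).
apply: (weight_swap wh01 (tri_swap3 Y _ _ closeh)).
exact: tri_swap2.
Qed.

End CutCount.

Lemma triT (R : realDomainType) (V : finType) (X Y Z : {set V}) :
  tri R X Y Z (fun _ _ => true) (fun _ _ => true) (fun _ _ => true) =
    #|X|%:R * #|Y|%:R * #|Z|%:R.
Proof.
rewrite /tri; under eq_bigr do under eq_bigr do under eq_bigr do rewrite !mulr1.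
by rewrite !sumr_const -!mulrnA -!natrM; congr _%:R; lia.
Qed.
(** * Regularity partitions *)

Lemma sum_subset (R : pzRingType) (V : finType) (A S : {set V}) (F : V -> R) :
  S \subset A -> \sum_(x in S) F x = \sum_(x in A) (x \in S)%:R * F x.
Proof.
move=> /setIidPr SA; rewrite -{1}SA.
under eq_bigl do rewrite inE; rewrite big_mkcondr; apply: eq_bigr => x _.
by case: (x \in S); rewrite ?mul1r ?mul0r.
Qed.

Section Energy.
Variables (R : realFieldType) (V : finType) (f : rel V).

Section Average.
Variables (I : finType) (p : V -> I).
Implicit Types (i j : I).

Definition block i := [set x | p x == i].

(** For an empty block the quotient is 0, by the convention for inverting 0; [density_block] holds
    in that case too. *)
Definition density i j : R :=
  (\sum_(x in block i) \sum_(y in block j) (f x y)%:R)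
    / (#|block i|%:R * #|block j|%:R).

(** The squared L2 norm of the block average of [f]. Summing over vertices instead of blocks builds
    in the block sizes as weights. *)
Definition energy : R := \sum_x \sum_y density (p x) (p y) ^+ 2.

Lemma density_ge0 i j : 0 <= density i j.
Proof.
by rewrite divr_ge0 ?mulr_ge0 //; do 2![apply: sumr_ge0 => ? _].
Qed.

Lemma sum_const_block i j (c : R) :
  \sum_(x in block i) \sum_(y in block j) c
    = c * (#|block i|%:R * #|block j|%:R).
Proof. by rewrite !sumr_const -mulrnA mulnC -natrM mulr_natr. Qed.

Lemma density_block i j :
  density i j * (#|block i|%:R * #|block j|%:R)
    = \sum_(x in block i) \sum_(y in block j) (f x y)%:R.
Proof.
have [b0|/divfK->//] := eqVneq (#|block i|%:R * #|block j|%:R : R) 0.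
rewrite b0 mulr0; move/eqP: b0; rewrite mulf_eq0 !pnatr_eq0 !cards_eq0.
by case/orP=> /eqP->; rewrite ?big_set0 // big1 // => x _; rewrite big_set0.
Qed.

Lemma density_le1 i j : density i j <= 1.
Proof.
rewrite /density; set b := _%:R * _%:R; have [->|b0] := eqVneq b 0.
  by rewrite invr0 mulr0.
have b_gt0 : 0 < b by rewrite lt0r b0 mulr_ge0.
rewrite ler_pdivrMr // -sum_const_block; apply: ler_sum => x _.
by apply: ler_sum => y _; rewrite lern1 leq_b1.
Qed.

Lemma partition_sum2 (G : V -> V -> R) :
  \sum_x \sum_y G x y
    = \sum_i \sum_j \sum_(x in block i) \sum_(y in block j) G x y.
Proof.
have part (H : V -> R) : \sum_x H x = \sum_i \sum_(x in block i) H x.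
  rewrite (partition_big p xpredT) //=; apply: eq_bigr => i _.
  by apply: eq_bigl => x; rewrite inE.
rewrite part; apply: eq_bigr => i _; rewrite exchange_big part.
by apply: eq_bigr => j _; rewrite exchange_big.
Qed.

(* Averaging is the orthogonal projection onto the functions constant on
   products of blocks. *)
Lemma sum_density_proj (k : I -> I -> R) :
  \sum_x \sum_y density (p x) (p y) * k (p x) (p y)
    = \sum_x \sum_y (f x y)%:R * k (p x) (p y).
Proof.
rewrite !partition_sum2; apply: eq_bigr => i _; apply: eq_bigr => j _.
transitivity (density i j * (#|block i|%:R * #|block j|%:R) * k i j).
  rewrite mulrAC -sum_const_block.
  apply: eq_bigr => x; rewrite inE => /eqP->; apply: eq_bigr => y.
  by rewrite inE => /eqP->.
rewrite density_block mulr_suml.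
apply: eq_bigr => x; rewrite inE => /eqP->; rewrite mulr_suml.
by apply: eq_bigr => y; rewrite inE => /eqP->.
Qed.

Lemma energy_le : energy <= #|V|%:R ^+ 2.
Proof.
apply: (@le_trans _ _ (\sum_(x : V) \sum_(y : V) 1)).
  apply: ler_sum => x _; apply: ler_sum => y _.
  by rewrite exprn_ile1 ?density_ge0 ?density_le1.
by rewrite !sumr_const -mulrnA expr2 -natrM .
Qed.

Definition discrepancy i j (ST : {set V} * {set V}) : R :=
  \sum_(x in ST.1) \sum_(y in ST.2) ((f x y)%:R - density i j).

Variable eps : R.

Definition witness i j (ST : {set V} * {set V}) : bool :=
  [&& ST.1 \subset block i, ST.2 \subset block j &
      eps * (#|block i|%:R * #|block j|%:R) < `|discrepancy i j ST|].

Definition irregular i j : bool := [exists ST, witness i j ST].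

(** Regular pairs receive two empty sets, so the correcting function of the energy increment
    vanishes on them without a case distinction. *)
Definition pick_witness i j := odflt (set0, set0) [pick ST | witness i j ST].

Lemma pick_witnessP i j : irregular i j -> witness i j (pick_witness i j).
Proof.
rewrite /pick_witness => /existsP[ST w]; case: pickP => //= /(_ ST).
by rewrite w.
Qed.

Lemma pick_witness0 i j : ~~ irregular i j -> pick_witness i j = (set0, set0).
Proof.
rewrite /pick_witness => /negP ir; case: pickP => //= ST w.
by case: ir; apply/existsP; exists ST.
Qed.

Lemma pick_witness_sub i j :
  (pick_witness i j).1 \subset block i /\ (pick_witness i j).2 \subset block j.
Proof.
have [/pick_witnessP/and3P[]//|/pick_witness0->] := boolP (irregular i j).
by rewrite !sub0set.
Qed.

Lemma regular_cut_close i j : ~~ irregular i j ->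
  cut_close (block i) (block j) f (fun _ _ => true) (density i j)
    (eps * (#|block i|%:R * #|block j|%:R)).
Proof.
move=> ir S T Si Tj; rewrite leNgt; apply: contra ir => w.
apply/existsP; exists (S, T); rewrite /witness /= Si Tj /=.
apply: lt_le_trans w _; rewrite le_eqVlt; apply/orP; left; apply/eqP.
congr `|_|; apply: eq_bigr => x _; apply: eq_bigr => y _.
by rewrite mulr1.
Qed.

End Average.

Section Refine.
Variables (I J : finType) (p : V -> I) (q : V -> J) (h : J -> I).
Hypothesis qK : forall x, p x = h (q x).
Variable eps : R.
Hypothesis eps_ge0 : 0 <= eps.
Variable mem1 : J -> I -> bool.
Variable mem2 : J -> I -> bool.
Hypothesis mem1P : forall x j,
  mem1 (q x) j = (x \in (pick_witness p eps (p x) j).1).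
Hypothesis mem2P : forall y i,
  mem2 (q y) i = (y \in (pick_witness p eps i (p y)).2).

(* With W and W' the block averages for p and q, the function u below equals
   +-eps on the chosen witnesses; it is constant on q-blocks, so
   |W' - W|^2 >= 2 <W' - W, u> - |u|^2 = 2 <f - W, u> - |u|^2. *)
Lemma energy_increment :
  energy p + eps ^+ 2 * (\sum_x \sum_y (irregular p eps (p x) (p y))%:R)
    <= energy q.
Proof.
pose W x y := density p (p x) (p y).
pose W' x y := density q (q x) (q y).
pose disc i j := discrepancy p i j (pick_witness p eps i j).
pose k (i j : J) := eps * Num.sg (disc (h i) (h j)) *
   (mem1 i (h j))%:R * (mem2 j (h i))%:R.
pose u x y := k (q x) (q y).
set B := \sum_x _.
have uE x y : u x y = eps * Num.sg (disc (p x) (p y)) *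
    (x \in (pick_witness p eps (p x) (p y)).1)%:R *
    (y \in (pick_witness p eps (p x) (p y)).2)%:R.
  by rewrite /u /k -!qK mem1P mem2P.
have projq (k' : J -> J -> R) : \sum_x \sum_y W' x y * k' (q x) (q y) =
    \sum_x \sum_y (f x y)%:R * k' (q x) (q y) by exact: sum_density_proj.
(* Both sides equal the inner product of [f] and [W]: [W] is constant on products of [p]-blocks and
   hence, by [qK], also on products of [q]-blocks. *)
have WW : \sum_x \sum_y W' x y * W x y = energy p.
  have -> : energy p = \sum_x \sum_y W x y * W x y.
    by apply: eq_bigr => x _; apply: eq_bigr => y _; rewrite expr2.
  rewrite /W (sum_density_proj p (fun i j => density p i j)).
  under eq_bigr do under eq_bigr do rewrite !qK.
  rewrite (projq (fun i j => density p (h i) (h j))).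
  by under [RHS]eq_bigr do under eq_bigr do rewrite !qK.
have Wu : \sum_x \sum_y W' x y * u x y = \sum_x \sum_y (f x y)%:R * u x y.
  exact: projq.
have uu : \sum_x \sum_y u x y ^+ 2 <= eps ^+ 2 * B.
  rewrite mulr_sumr; apply: ler_sum => x _; rewrite mulr_sumr.
  apply: ler_sum => y _; rewrite uE.
  have [ir|/pick_witness0->] := boolP (irregular _ _ _ _); last first.
    by rewrite !inE !mulr0 expr0n.
  set b1 := x \in _; set b2 := y \in _; set s := Num.sg _.
  have -> : (eps * s * b1%:R * b2%:R) ^+ 2
      = eps ^+ 2 * (s ^+ 2 * (b1%:R ^+ 2 * b2%:R ^+ 2)) by ring.
  rewrite mulr1 ler_piMr ?sqr_ge0 //.
  have b01 (b : bool) : 0 <= (b%:R : R) ^+ 2 <= 1.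
    by case: b; rewrite ?expr1n ?expr0n ?lexx ?ler01.
  have /andP[? ?] := b01 b1; have /andP[? ?] := b01 b2.
  have /andP[? ?] : 0 <= s ^+ 2 <= 1.
    by rewrite /s sqr_sg; case: (_ != 0); rewrite ?lexx ?ler01.
  apply: mulr_ile1 => //; first exact: mulr_ge0.
  exact: mulr_ile1.
(* On a pair of blocks the inner product is [eps] times the absolute discrepancy of the witness,
   because [u] carries its sign; irregularity bounds that discrepancy below by [eps] times the
   product of the block sizes. *)
have fu : eps ^+ 2 * B <= \sum_x \sum_y ((f x y)%:R - W x y) * u x y.
  rewrite /B !(partition_sum2 p) mulr_sumr; apply: ler_sum => i _.
  rewrite mulr_sumr; apply: ler_sum => j _.
  have -> : \sum_(x in block p i) \sum_(y in block p j)
      ((f x y)%:R - W x y) * u x y = eps * `|disc i j|.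
    rewrite normrEsg mulrA; set s := _ * Num.sg _; rewrite /disc /discrepancy.
    have [s1 s2] := pick_witness_sub p eps i j.
    rewrite (sum_subset _ s1) mulr_sumr; apply: eq_bigr => x.
    rewrite inE => /eqP px; rewrite (sum_subset _ s2) !mulr_sumr.
    by apply: eq_bigr => y; rewrite inE => /eqP py; rewrite uE -/s /W px py -/s; ring.
  apply: (@le_trans _ _ (eps ^+ 2 * ((irregular p eps i j)%:R *
      (#|block p i|%:R * #|block p j|%:R)))).
    rewrite -sum_const_block ler_wpM2l ?sqr_ge0 //.
    apply: ler_sum => x; rewrite inE => /eqP->; apply: ler_sum => y.
    by rewrite inE => /eqP->.
  rewrite expr2 -mulrA ler_wpM2l //.
  have [/pick_witnessP/and3P[_ _ /ltW]|_] := boolP (irregular _ _ _ _).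
    by rewrite mul1r.
  by rewrite mul0r mulr0.
have ge0 : 0 <= \sum_x \sum_y (W' x y - W x y - u x y) ^+ 2.
  by do 2![apply: sumr_ge0 => ? _]; rewrite sqr_ge0.
have eqn : \sum_x \sum_y (W' x y - W x y - u x y) ^+ 2 =
   energy q + energy p + \sum_x \sum_y u x y ^+ 2
   - 2 * (\sum_x \sum_y W' x y * W x y)
   - 2 * (\sum_x \sum_y ((f x y)%:R - W x y) * u x y)
   - 2 * ((\sum_x \sum_y W' x y * u x y)
         - (\sum_x \sum_y (f x y)%:R * u x y)).
  rewrite !(mulr_sumr, =^~sumrB, =^~big_split) /=; apply: eq_bigr => x _.
  rewrite !(mulr_sumr, =^~sumrB, =^~big_split) /=; apply: eq_bigr => y _.
  by rewrite -/(W x y) -/(W' x y); ring.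
rewrite eqn WW Wu subrr in ge0.
by move: ge0 uu fu; set a := \sum_x _; set b := \sum_x _; nra.
Qed.

End Refine.
End Energy.

Section Regularity.
Variables (R : archiRealFieldType) (K : finType) (eps : R).
Hypothesis eps_gt0 : 0 < eps.

Definition bad_mass (V I : finType) (f : K -> rel V) (p : V -> I) : R :=
  \sum_a \sum_x \sum_y (irregular (f a) p eps (p x) (p y))%:R.

(** The new label of a vertex records its old class together with two membership bits for each
    colour and each class, one per side of the witness. All witnesses become unions of new classes,
    for all colours at once. *)
Lemma refine_partition (V I : finType) (f : K -> rel V) (p : V -> I) :
  exists (J : finType) (q : V -> J) (h : J -> I),
    [/\ #|J| = (#|I| * 4 ^ (#|K| * #|I|))%N, forall x, p x = h (q x)
      & \sum_a energy R (f a) p + eps ^+ 2 * bad_mass f p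
          <= \sum_a energy R (f a) q].
Proof.
pose wit a := pick_witness (f a) p eps.
pose q x : I * {ffun K * I -> bool * bool} := (p x, [ffun aj : K * I =>
  (x \in (wit aj.1 (p x) aj.2).1, x \in (wit aj.1 aj.2 (p x)).2)]).
exists _, q, fst; split=> //.
  by rewrite card_prod card_ffun !card_prod card_bool.
rewrite mulr_sumr -big_split; apply: ler_sum => a _ /=.
apply: (@energy_increment R V (f a) I _ p q fst _ eps (ltW eps_gt0)
  (fun j i => (j.2 (a, i)).1) (fun j i => (j.2 (a, i)).2)) => //.
- by move=> x j; rewrite /= ffunE.
- by move=> y i; rewrite /= ffunE.
Qed.

(** Every refinement of a partition with too much irregular mass raises the total energy by
    [eps ^+ 3 * #|V|%:R ^+ 2], while [energy_le] bounds it by [#|K|%:R * #|V|%:R ^+ 2]. The number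
    of rounds, and so [M], is independent of [V]. *)
Lemma regular_partition (m0 : nat) : exists M : nat,
  forall (V I0 : finType) (f : K -> rel V) (p0 : V -> I0), (#|I0| <= m0)%N ->
  exists (I : finType) (p : V -> I) (h : I -> I0),
    [/\ (#|I| <= M)%N, forall x, p0 x = h (p x)
      & bad_mass f p <= eps * #|V|%:R ^+ 2].
Proof.
have step k : exists M : nat,
    forall (V I0 : finType) (f : K -> rel V) (p0 : V -> I0), (#|I0| <= m0)%N ->
    exists (I : finType) (p : V -> I) (h : I -> I0),
    [/\ (#|I| <= M)%N, forall x, p0 x = h (p x)
      & bad_mass f p <= eps * #|V|%:R ^+ 2 \/
        k%:R * (eps ^+ 3 * #|V|%:R ^+ 2) <= \sum_a energy R (f a) p].
  elim: k => [|k [M IH]].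
    exists m0 => V I0 f p0 le_m0; exists I0, p0, id; split=> //; right.
    by rewrite mul0r; do 3![apply: sumr_ge0 => ? _]; rewrite sqr_ge0.
  exists (M * 4 ^ (#|K| * M))%N => V I0 f p0 /(IH _ _ f p0).
  move=> [I [p [h [le_M p0E bad]]]].
  have le_M' : (#|I| * 4 ^ (#|K| * #|I|) <= M * 4 ^ (#|K| * M))%N.
    by rewrite leq_mul // leq_pexp2l // leq_mul2l le_M orbT.
  have [good|not_good] := lerP (bad_mass f p) (eps * #|V|%:R ^+ 2).
    exists I, p, h; split=> //; last by left.
    by apply: leq_trans le_M' => //; rewrite leq_pmulr // expn_gt0.
  case: bad => [|bad]; first by rewrite leNgt not_good.
  have [J [q [g [cardJ pE inc]]]] := refine_partition f p.
  exists J, q, (h \o g); split.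
  - by rewrite cardJ.
  - by move=> x; rewrite p0E pE.
  right; apply: le_trans inc; rewrite -natr1 mulrDl mul1r lerD //.
  by rewrite exprSr -mulrA ler_wpM2l ?sqr_ge0 // ltW.
(* After more than [#|K|%:R / eps ^+ 3] rounds the energy alternative contradicts the upper bound,
   provided [V] is nonempty; the empty case is settled separately below. *)
pose k := (Num.truncn (#|K|%:R / eps ^+ 3 : R)).+1.
have [M HM] := step k; exists M => V I0 f p0 /(HM _ _ f p0).
move=> [I [p [h [le_M p0E bad]]]]; exists I, p, h; split=> //.
case: bad => // /le_trans /(_ (ler_sum _ (fun a _ => energy_le R (f a) p))).
rewrite sumr_const -[X in _ <= X]mulr_natl mulrA => le_k.
have [n0|n_gt0] := leqP #|V| 0; last first.
  move: le_k; rewrite ler_pM2r ?exprn_gt0 ?ltr0n // -ler_pdivlMr ?exprn_gt0 //.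
  by rewrite leNgt truncnS_gt.
rewrite /bad_mass big1 ?mulr_ge0 ?exprn_ge0 // 1?ltW // => a _.
rewrite big1 // => x _.
by have := max_card (pred1 x); rewrite card1 leqNgt ltnS n0.
Qed.

End Regularity.

(** * Homogeneous triples of sets *)

Section Ramsey.
Variable K : finType.

Lemma pairwiseN (T : eqType) (r : rel T) (s : seq T) : ~~ pairwise r s ->
  exists x y, subseq [:: x; y] s /\ ~~ r x y.
Proof.
elim: s => //= x s IH; rewrite negb_and => /orP[/allPn[y ys nr]|/IH].
  by exists x, y; split=> //=; rewrite eqxx sub1seq.
move=> [y [z [sub nr]]]; exists y, z; split=> //.
exact: subseq_trans sub (subseq_cons _ _).
Qed.

Lemma sum_count_colours (T : eqType) (g : T -> K) (C : {set K}) (s : seq T) :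
  all (fun y => g y \in C) s ->
  (\sum_(a in C) count (fun y => g y == a) s = size s)%N.
Proof.
elim: s => [|y s IH] /= => [_|/andP[yC /IH<-]]; first by rewrite big1.
rewrite big_split /= (bigD1 (g y)) //= eqxx big1 ?addn0 //.
by move=> a /andP[_ /negPf]; rewrite eq_sym => ->.
Qed.

(** Induction on the number of colours that occur. By pigeonhole the head [x] sends one colour [a]
    to many later elements. Either two of these are joined by [a], which closes a triangle, or [a]
    is absent among them and the induction applies. The function [c] is only read along the order of
    the list, so it need not be symmetric. *)
Lemma ramsey_triangle : exists N : nat,
  forall (T : eqType) (c : T -> T -> K) (s : seq T), (N <= size s)%N ->
  exists x y z, [/\ subseq [:: x; y; z] s, c x y = c x z & c x y = c y z].
Proof.
suff step k : exists N : nat, forall (T : eqType) (c : T -> T -> K)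
    (C : {set K}) (s : seq T), (#|C| <= k)%N -> (N <= size s)%N ->
    pairwise (fun x y => c x y \in C) s ->
    exists x y z, [/\ subseq [:: x; y; z] s, c x y = c x z & c x y = c y z].
  have [N HN] := step #|K|; exists N => T c s sizes.
  apply: (HN _ _ setT) => //; first by rewrite cardsT.
  by elim: s {sizes} => //= x s ->; rewrite andbT; apply/allP => y; rewrite inE.
elim: k => [|k [N IH]].
  exists 2%N => T c C [|x [|y s]] //; rewrite leqn0 cards_eq0 => /eqP-> _ /=.
  by rewrite inE.
exists (N.+1 * k.+1).+1 => T c C [|x s] //= cardC; rewrite ltnS => sizes.
move=> /andP[xC pC].
have [a aC leN] : exists2 a, a \in C & (N < count (fun y => c x y == a) s)%N.
  apply/exists_inP; apply: contraLR sizes; rewrite negb_exists_in -ltnNge.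
  move=> /forall_inP small; rewrite -(sum_count_colours xC).
  apply: (@leq_ltn_trans (\sum_(a in C) N)).
    by apply: leq_sum => a /small; rewrite -leqNgt.
  by rewrite sum_nat_const; nia.
set t := filter (fun y => c x y == a) s.
have ts : subseq t s by exact: filter_subseq.
have ta y : y \in t -> c x y = a by rewrite mem_filter => /andP[/eqP].
have [noa|/pairwiseN[y [z [yz]]]] :=
    boolP (pairwise (fun y z => c y z != a) t); last first.
  move=> /negPn/eqP yza; exists x, y, z.
  rewrite /= eqxx (subseq_trans yz ts); split=> //;
    by rewrite !ta ?(mem_subseq yz) ?inE ?eqxx ?orbT.
have pCa : pairwise (fun y z => c y z \in C :\ a) t.
  have : pairwise [rel y z | (c y z != a) && (c y z \in C)] t.
    by rewrite pairwise_relI noa (subseq_pairwise ts pC).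
  by apply: sub_pairwise => y z /=; rewrite in_setD1.
have [||y [u [v [sub e1 e2]]]] := IH T c (C :\ a) t _ _ pCa.
- by move: cardC; rewrite (cardsD1 a) aC.
- by rewrite size_filter ltnW.
exists y, u, v; split=> //.
exact: subseq_trans sub (subseq_trans ts (subseq_cons _ _)).
Qed.

End Ramsey.

(** Greedy choice. By averaging, fewer than half of the vertices have more than [n / (2 * m)] bad
    neighbours. Avoiding these, each chosen vertex excludes at most [n / (2 * m)] vertices, so fewer
    than [m] choices never exhaust the other half. *)
Lemma sparse_independent (V : finType) (bad : rel V) (m : nat) :
  symmetric bad -> (4 * m * (\sum_x \sum_y bad x y) < #|V| ^ 2)%N ->
  exists2 s : seq V, size s = m & pairwise (fun x y => ~~ bad x y) s.
Proof.
move=> bad_sym sparse; set n := #|V| in sparse *.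
pose N x := [set y | bad x y]; pose high := [set x | (n < 2 * m * #|N x|)%N].
have NE x : #|N x| = (\sum_y bad x y)%N by rewrite cardsE -sum1_card big_mkcond.
have high_small : (2 * #|high| < n)%N.
  have : (#|high| * n <= 2 * m * (\sum_x \sum_y bad x y))%N.
    rewrite -sum_nat_const big_distrr /= [leqRHS](bigID (mem high)) /=.
    apply: leq_trans (leq_addr _ _); apply: leq_sum => x.
    by rewrite inE -NE => /ltnW.
  by move: sparse; move: (\sum_x _)%N => B; nia.
suff H k : (k <= m)%N -> exists s : seq V, [/\ size s = k,
    all (fun x => x \notin high) s & pairwise (fun x y => ~~ bad x y) s].
  by have [s []] := H m (leqnn m); exists s.
elim: k => [_|k IH km]; first by exists [::].
have [s [sizes shigh ps]] := IH (ltnW km).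
pose U := high :|: \bigcup_(x <- s) N x.
have le_U : (2 * m * #|\bigcup_(x <- s) N x| <= size s * n)%N.
  elim: s shigh {IH sizes ps U} => [|x s IHs] /=.
    by rewrite big_nil cards0 muln0.
  rewrite big_cons inE -leqNgt => /andP[hx /IHs les].
  rewrite mulSn; apply: leq_trans (leq_add hx les); rewrite -mulnDr leq_mul2l.
  by rewrite leq_card_setU orbT.
have /set0Pn[x] : ~: U != set0.
  rewrite -card_gt0 cardsCs setCK subn_gt0 -/n.
  have := leq_card_setU high (\bigcup_(x <- s) N x); rewrite -/U.
  move: le_U high_small; rewrite sizes; move: #|U| #|high| #|_| => u h v.
  move=> le_v lt_h le_u; rewrite -(@ltn_pmul2l (2 * m)); last by lia.
  have := leq_mul (leqnn m) lt_h; have := leq_mul km (leqnn n).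
  by have := leq_mul (leqnn (2 * m)) le_u; lia.
rewrite !inE negb_or => /andP[xhigh xN]; exists (x :: s); split=> /=.
- by rewrite sizes.
- by rewrite shigh andbT inE.
rewrite ps andbT; apply/allP => y ys; apply: contra xN => xy.
by rewrite bigcup_seq; apply/bigcupP; exists y; rewrite // inE bad_sym.
Qed.

Section Intervals.
Variables (V : finType) (r : V -> nat).
Hypothesis r_inj : injective r.

Lemma interval_partition (k : nat) : (0 < k)%N ->
  exists idx : V -> 'I_k, (forall x y, (idx x < idx y)%N -> (r x < r y)%N) /\
    (\sum_x \sum_y (idx x == idx y) <= #|V| * (#|V| %/ k).+1)%N.
Proof.
(* The successor makes [k * L] exceed [n], so that dividing a rank by [L] gives an index below [k].
   Ranks within one interval differ modulo [L], which bounds its size by [L]. *)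
move=> k_gt0; set n := #|V|; set L := (n %/ k).+1.
pose rank x := #|[set y | (r y < r x)%N]|.
have rank_lt x : (rank x < n)%N.
  rewrite /n -cardsT; apply: proper_card; rewrite properE subsetT.
  by apply/subsetPn; exists x; rewrite ?inE ?ltnn.
have rank_mono x y : (r x < r y)%N -> (rank x < rank y)%N.
  move=> xy; apply: proper_card; rewrite properE; apply/andP; split.
    by apply/subsetP => z; rewrite !inE => /ltn_trans; apply.
  by apply/subsetPn; exists x; rewrite !inE ?ltnn.
have rank_inj : injective rank.
  move=> x y e; apply: r_inj.
  by case: (ltngtP (r x) (r y)) => // /rank_mono; rewrite e ltnn.
have idx_lt x : (rank x %/ L < k)%N.
  rewrite ltn_divLR // (leq_trans (rank_lt x)) //.
  by have := ltn_ceil n k_gt0; rewrite mulnC -/L => /ltnW.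
exists (fun x => Ordinal (idx_lt x)); split=> /= [x y xy|].
  rewrite ltnNge leq_eqVlt; apply/negP => /orP[/eqP/r_inj e|/rank_mono yx].
    by move: xy; rewrite e ltnn.
  by move: xy; rewrite ltnNge leq_div2r // ltnW.
rewrite -sum_nat_const; apply: leq_sum => x _.
set i := Ordinal (idx_lt x); set F := [set y | i == Ordinal (idx_lt y)].
have -> : (\sum_y (i == Ordinal (idx_lt y)) = #|F|)%N.
  by rewrite /F cardsE -sum1_card [RHS]big_mkcond.
rewrite -[leqRHS](card_ord L).
rewrite -(card_in_imset (f := fun y => inord (rank y %% L) : 'I_L)) ?max_card //.
move=> y z; rewrite !inE {F}/i => /eqP/(congr1 val)/= ey /eqP/(congr1 val)/= ez.
move=> /(congr1 val)/=; rewrite !inordK ?ltn_mod // => emod.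
by apply: rank_inj; rewrite (divn_eq (rank y) L) (divn_eq (rank z) L) -ey ez emod.
Qed.

End Intervals.

Section Rounding.
Variables (R : archiRealFieldType) (K : finType) (m : nat).

(** Rounding turns density vectors into finitely many colours for Ramsey's theorem. The value [m]
    itself occurs, when [w a] is 1, whence ['I_m.+1]. *)
Definition rounding (w : K -> R) : {ffun K -> 'I_m.+1} :=
  [ffun a => inord (Num.truncn (w a * m%:R))].

Lemma rounding_close (v w : K -> R) a : (0 < m)%N ->
  (forall b, 0 <= v b <= 1) -> (forall b, 0 <= w b <= 1) ->
  rounding v = rounding w -> `|v a - w a| <= m%:R^-1.
Proof.
move=> m_gt0 v01 w01 /ffunP/(_ a)/(congr1 val); rewrite !ffunE /= => e.
have bound (u : K -> R) : (forall b, 0 <= u b <= 1) ->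
    (Num.truncn (u a * m%:R))%:R <= u a * m%:R < (Num.truncn (u a * m%:R)).+1%:R
    /\ (Num.truncn (u a * m%:R) < m.+1)%N.
  move=> /(_ a)/andP[u0 u1]; rewrite truncn_itv ?mulr_ge0 //; split=> //.
  rewrite ltnS truncn_le_nat (@le_lt_trans _ _ m%:R) ?ltr_nat //.
  by rewrite ler_piMl.
have [/andP[v1 v2] v3] := bound v v01; have [/andP[w1 w2] w3] := bound w w01.
move: e; rewrite !inordK // => e; rewrite e in v1 v2.
rewrite -(@ler_pM2r _ m%:R) ?ltr0n // mulVf ?pnatr_eq0 -?lt0n //.
rewrite -[X in _ * X]ger0_norm // -normrM mulrBl ler_norml.
by move: v1 v2 w1 w2; rewrite -natr1; lra.
Qed.

End Rounding.

Lemma pairwise_sym_in (T : eqType) (e : rel T) (s : seq T) : symmetric e ->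
  pairwise e s -> {in s &, forall x y, x != y -> e x y}.
Proof.
move=> e_sym; elim: s => //= x s IH /andP[/allP xs /IH{}IH] y z.
rewrite !inE => /predU1P[->|ys] /predU1P[->|zs] yz.
- by rewrite eqxx in yz.
- exact: xs.
- by rewrite e_sym; exact: xs.
- exact: IH.
Qed.

Section Homogeneous.
Variables (R : archiRealFieldType) (K : finType).

(** One vector [x] describes all three pairs of parts. This makes the notion symmetric in the parts
    and lets [x] be compared with a point of the simplex. *)
Definition homogeneous (V : finType) (col : V -> V -> K) (x : K -> R) (eps : R)
    (X Y Z : {set V}) : Prop :=
  forall a b c,
    `|tri R X Y Z (fun u v => col u v == a) (fun u v => col u v == b)
        (fun u v => col u v == c) - x a * x b * x c * (#|X|%:R * #|Y|%:R * #|Z|%:R)|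
      <= eps * (#|X|%:R * #|Y|%:R * #|Z|%:R).

Lemma sum_density1 (V I : finType) (col : V -> V -> K) (p : V -> I) i j :
  block p i != set0 -> block p j != set0 ->
  \sum_a density R (fun u v => col u v == a) p i j = 1.
Proof.
rewrite -!card_gt0 => bi bj; rewrite -mulr_suml exchange_big /=.
under eq_bigr => u _.
  rewrite exchange_big; under eq_bigr => v _.
    rewrite (bigD1 (col u v)) //= eqxx big1 ?addr0.
    over.
    by move=> a /negPf; rewrite eq_sym => ->.
  over.
by rewrite sum_const_block mul1r divff // mulf_neq0 // pnatr_eq0 -lt0n.
Qed.

Lemma small_blocks (V I : finType) (p : V -> I) (d : R) : 0 <= d ->
  \sum_x (#|block p (p x)|%:R < d)%R%:R <= #|I|%:R * d.
Proof.
move=> d0; rewrite (partition_big p xpredT) //= -sum1_card natr_sum mulr_suml.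
apply: ler_sum => i _.
rewrite (eq_bigr (fun=> (#|block p i|%:R < d)%R%:R)) => [|x /eqP->//].
rewrite sumr_const mul1r -mulr_natl -(cardsE (fun x => p x == i)) -/(block p i).
by case: ltP => [/ltW|_] /=; rewrite ?mulr1 ?mul0rn.
Qed.

(** Blocks are chosen through representative vertices: a uniformly weighted vertex selects a block
    with probability proportional to its size. Pairs of vertices lying in a common interval, in
    small blocks or in irregular pairs of blocks are sparse, so many pairwise good vertices exist,
    and Ramsey's theorem on rounded densities, along the interval order, selects three of them. *)
Lemma homogeneous_triple (eps : R) : 0 < eps ->
  exists (delta : R) (N : nat), 0 < delta /\
  forall (V : finType) (r : V -> nat) (col : V -> V -> K),
    injective r -> (N <= #|V|)%N ->
  exists (x : K -> R) (A B C : {set V}),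
    [/\ [/\ forall a, 0 <= x a <= 1, \sum_a x a = 1
          & homogeneous col x eps A B C],
        [/\ delta * #|V|%:R <= #|A|%:R, delta * #|V|%:R <= #|B|%:R
          & delta * #|V|%:R <= #|C|%:R]
      & {in A & B, forall u v, (r u < r v)%N} /\
        {in B & C, forall u v, (r u < r v)%N}].
Proof.
move=> eps_gt0.
pose q := (Num.truncn (4 / eps)).+1.
have q_large : (q%:R : R)^-1 <= eps / 4.
  rewrite -[_ / _]invrK lef_pV2 ?posrE ?invr_gt0 ?divr_gt0 ?ltr0n //.
  by rewrite invf_div ltW // truncnS_gt.
have [m0 Hm0] := ramsey_triangle {ffun K -> 'I_q.+1}.
pose m := m0.+1; pose mR : R := m%:R.
have m_gt0 : 0 < mR by rewrite ltr0n.
(* The first bound makes the counting error [3 * gam] at most [eps / 2]; the second keeps the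
   irregular pairs below [n ^ 2 / (32 * m)]. The choices of [k] and [delta] give the same bound for
   pairs in one interval and, up to a factor [n], for vertices in small blocks. *)
pose gam : R := Num.min (eps / 6) (1 / (32 * mR)).
have gam_gt0 : 0 < gam by rewrite lt_min !divr_gt0 // mulr_gt0.
pose k := (64 * m)%N.
have [M HM] := regular_partition K gam_gt0 k.
pose delta : R := (32 * mR * M.+1%:R)^-1.
have delta_gt0 : 0 < delta by rewrite invr_gt0 !mulr_gt0.
exists delta, k; split=> // V r col r_inj le_n.
pose n := #|V|; pose nR : R := n%:R.
have n_gt0 : (0 < n)%N by apply: leq_trans le_n.
have nR_gt0 : 0 < nR by rewrite ltr0n.
have [idx [idx_lt idx_mass]] := interval_partition r_inj (isT : (0 < k)%N).
pose f a := (fun u v => col u v == a) : rel V.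
have [|I [p [h [cardI pE mass]]]] := HM V _ f idx; first by rewrite card_ord.
pose small i := #|block p i|%:R < delta * nR.
pose irr i j := [exists a, irregular (f a) p gam i j].
(* Irregularity is tested in both orders to make [bad] symmetric. The first alternative makes it
   reflexive, so a list of pairwise good vertices has no repetition. *)
pose bad x y := [|| idx x == idx y, small (p x), small (p y),
  irr (p x) (p y) | irr (p y) (p x)].
have bad_sym : symmetric bad.
  move=> x y; rewrite /bad eq_sym; congr (_ || _).
  by rewrite !orbA (orbC (small _)) -!orbA; do 2!congr (_ || _); rewrite orbC.
have sparse : (4 * m * (\sum_x \sum_y bad x y) < #|V| ^ 2)%N.
  pose S1 : R := \sum_x \sum_y (idx x == idx y)%:R.
  pose S2 : R := \sum_x (small (p x))%:R.
  pose S3 : R := \sum_x \sum_y (irr (p x) (p y))%:R.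
  have le_S : ((\sum_x \sum_y bad x y)%N%:R : R) <= S1 + 2 * nR * S2 + 2 * S3.
    have -> : 2 * nR * S2 = \sum_x \sum_(y : V) (small (p x))%:R
         + \sum_(x : V) \sum_y (small (p y))%:R.
      rewrite [X in _ = _ + X]exchange_big /=.
      under [X in X + _]eq_bigr do rewrite sumr_const.
      under [X in _ + X]eq_bigr do rewrite sumr_const.
      by rewrite sumrMnl -/S2 -[S2 *+ _]mulr_natl -/n -/nR; ring.
    have -> : 2 * S3 = S3 + \sum_x \sum_y (irr (p y) (p x))%:R.
      by rewrite [X in _ = _ + X]exchange_big -/S3; ring.
    rewrite natr_sum -!big_split /=; apply: ler_sum => x _.
    rewrite natr_sum -!big_split /=; apply: ler_sum => y _.
    rewrite -!natrD ler_nat /bad; case: (_ == _); case: (small _);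
      by case: (small _); case: (irr _ _); case: (irr _ _).
  have le_S1 : S1 <= nR * (nR / k%:R + 1).
    have -> : S1 = (\sum_x \sum_y (idx x == idx y))%N%:R.
      by rewrite natr_sum; apply: eq_bigr => x _; rewrite natr_sum.
    apply: (@le_trans _ _ (n * (n %/ k).+1)%N%:R); first by rewrite ler_nat.
    rewrite natrM ler_wpM2l // -natr1 lerD2r ler_pdivlMr ?ltr0n //.
    by rewrite -natrM ler_nat leq_trunc_div.
  have le_S2 : S2 <= M%:R * (delta * nR).
    apply: le_trans (small_blocks _ _) _; first by rewrite mulr_ge0 // ltW.
    by rewrite ler_wpM2r ?ler_nat // mulr_ge0 // ltW.
  have le_S3 : S3 <= gam * nR ^+ 2.
    apply: le_trans mass; rewrite /bad_mass exchange_big.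
    apply: ler_sum => x _; rewrite exchange_big; apply: ler_sum => y _.
    rewrite /irr; case: existsP => [[a ira]|_]; last by apply: sumr_ge0.
    by rewrite (bigD1 a) //= ira lerDl sumr_ge0.
  rewrite -(ltr_nat R) natrM natrX natrM -/mR -/nR.
  have gam_le : gam * nR ^+ 2 <= nR ^+ 2 / (32 * mR).
    by rewrite mulrC ler_wpM2l ?sqr_ge0 // -[_^-1]mul1r ge_min lexx orbT.
  have Md : M%:R * (delta * nR) <= nR / (32 * mR).
    have -> : M%:R * (delta * nR) = nR / (32 * mR) * (M%:R / M.+1%:R).
      by rewrite /delta; field; rewrite nat1r !pnatr_eq0.
    rewrite ler_piMr ?divr_ge0 ?mulr_ge0 //.
    by rewrite ler_pdivrMr ?ltr0n // mul1r ler_nat.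
  have kn : nR * (nR / k%:R + 1) <= nR ^+ 2 / (32 * mR).
    have k64 : k%:R = 64 * mR by rewrite natrM.
    rewrite expr2 -mulrA ler_wpM2l // k64.
    have : 1 <= nR / (64 * mR).
      by rewrite ler_pdivlMr ?mulr_gt0 // mul1r -k64 ler_nat.
    have -> : nR / (32 * mR) = 2 * (nR / (64 * mR)).
      by field; rewrite gt_eqF.
    by lra.
  (* Five units of [n ^ 2 / (32 * m)]: one for common intervals, two for small blocks and two for
     irregular pairs. The total factor is 20/32, below 1. *)
  apply: (@le_lt_trans _ _ (4 * mR * (5 * (nR ^+ 2 / (32 * mR))))); last first.
    have -> : 4 * mR * (5 * (nR ^+ 2 / (32 * mR))) = 20 / 32 * nR ^+ 2.
      by field; rewrite gt_eqF.
    by rewrite gtr_pMl ?exprn_gt0 //; lra.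
  rewrite ler_wpM2l ?mulr_ge0 //.
  apply: le_trans le_S _.
  have : nR * S2 <= nR ^+ 2 / (32 * mR).
    by rewrite expr2 -mulrA ler_wpM2l // (le_trans le_S2).
  by move: (le_trans le_S1 kn) (le_trans le_S3 gam_le); lra.
have [s sizes ps] := sparse_independent bad_sym sparse.
have s_uniq : uniq s.
  have /pairwise_uniq := ps; apply.
  by move=> x; rewrite /bad eqxx.
pose le_idx x y := (idx x <= idx y)%N.
pose s' := sort le_idx s.
have s'_sorted : sorted le_idx s'.
  by apply: sort_sorted => x y; exact: leq_total.
pose W v w a := density R (f a) p (p v) (p w).
have W01 v w a : 0 <= W v w a <= 1 by rewrite density_ge0 density_le1.
have [|x [y [z [sub e1 e2]]]] :=
    Hm0 V (fun v w => rounding q (W v w)) s'.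
  by rewrite size_sort sizes.
have sub3 := subseq_uniq sub; rewrite sort_uniq s_uniq in sub3.
have {sub3} /andP[] := sub3 isT.
rewrite !inE negb_or => /andP[xy xz] /andP[yz _].
have le_trans_idx : transitive le_idx by move=> ? ? ?; exact: leq_trans.
have /= := subseq_sorted le_trans_idx sub s'_sorted.
rewrite andbT => /andP[le_xy le_yz].
have ins v : v \in [:: x; y; z] -> v \in s.
  by move=> /(mem_subseq sub); rewrite mem_sort.
have xs : x \in s by rewrite ins ?inE ?eqxx.
have ys : y \in s by rewrite ins ?inE ?eqxx ?orbT.
have zs : z \in s by rewrite ins ?inE ?eqxx ?orbT.
have nbad_sym : symmetric (fun v w => ~~ bad v w).
  by move=> v w; rewrite bad_sym.
have := pairwise_sym_in nbad_sym ps.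
move=> good; have gxy := good _ _ xs ys xy; have gxz := good _ _ xs zs xz.
have {good} gyz := good _ _ ys zs yz.
have big v w : ~~ bad v w ->
    [/\ delta * nR <= #|block p (p v)|%:R, delta * nR <= #|block p (p w)|%:R
      & idx v != idx w].
  by rewrite !negb_or -!leNgt => /and5P[].
have close v w a : ~~ bad v w -> cut_close (block p (p v)) (block p (p w))
    (f a) (fun _ _ => true) (W v w a)
    (gam * (#|block p (p v)|%:R * #|block p (p w)|%:R)).
  rewrite !negb_or => /and5P[_ _ _ ir _]; apply: regular_cut_close.
  by apply: contra ir => ir; apply/existsP; exists a.
have lt_block v w : (idx v <= idx w)%N -> idx v != idx w ->
    {in block p (p v) & block p (p w), forall u u', (r u < r u')%N}.
  move=> le_vw ne u u'; rewrite !inE => /eqP pu /eqP pu'; apply: idx_lt.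
  by rewrite !pE pu pu' -!pE ltn_neqAle le_vw andbT.
have [bx by' nxy] := big _ _ gxy; have [_ bz nyz] := big _ _ gyz.
have block_gt0 v : delta * nR <= #|block p (p v)|%:R -> block p (p v) != set0.
  move=> b; rewrite -card_gt0 -(ltr0n R) (lt_le_trans _ b) //.
  by rewrite mulr_gt0.
exists (W x y), (block p (p x)), (block p (p y)), (block p (p z)); split=> //.
- split=> //; first by apply: sum_density1; exact: block_gt0.
  move=> a b c.
  have := tri_count3 (W01 x y a) (W01 x z c) (close _ _ a gxy) (close _ _ c gxz)
    (close _ _ b gyz).
  rewrite triT.
  set X := #|block p (p x)|%:R; set Y := #|block p (p y)|%:R.
  set Z := #|block p (p z)|%:R; set T := tri _ _ _ _ _ _ _ => count.
  have XYZ0 : 0 <= X * Y * Z by rewrite !mulr_ge0.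
  have dc := rounding_close c (ltn0Sn _) (W01 x y) (W01 x z) e1.
  have db := rounding_close b (ltn0Sn _) (W01 x y) (W01 y z) e2.
  have gam_le : gam <= eps / 6 by rewrite ge_min lexx.
  (* The true densities of the pairs [y z] and [x z] are traded for those of [x y]. Equal roundings
     cost [q%:R^-1] per trade, hence at most [eps / 2] in total. *)
  have -> : T - W x y a * W x y b * W x y c * (X * Y * Z) =
     (T - W x y a * (W x z c * (W y z b * (X * Y * Z)))) -
     W x y a * ((W x y b - W y z b) * W x y c + W y z b * (W x y c - W x z c))
       * (X * Y * Z) by ring.
  apply: le_trans (ler_normB _ _) _.
  apply: (@le_trans _ _ (3 * gam * (X * Y * Z) + 2 * q%:R^-1 * (X * Y * Z))).
    apply: lerD.
      apply: le_trans count _; rewrite le_eqVlt; apply/orP; left; apply/eqP.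
      by ring.
    rewrite normrM (ger0_norm XYZ0) ler_wpM2r //.
    have /andP[? ?] := W01 x y a; rewrite normrM ger0_norm //.
    have le2 : `|(W x y b - W y z b) * W x y c + W y z b * (W x y c - W x z c)|
        <= 2 * q%:R^-1.
      rewrite mulr_natl mulr2n; apply: le_trans (ler_normD _ _) _.
      have /andP[? ?] := W01 x y c; have /andP[? ?] := W01 y z b.
      rewrite (normrM (_ - _)) (normrM (W _ _ _)) (ger0_norm (x := W x y c)) //.
      rewrite (ger0_norm (x := W y z b)) //; apply: lerD.
        by apply: le_trans db; rewrite ler_piMr.
      by apply: le_trans dc; rewrite ler_piMl.
    by apply: le_trans le2; rewrite ler_piMl.
  rewrite -mulrDl ler_wpM2r //; move: q_large gam_le; lra.
by split; apply: lt_block.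
Qed.

End Homogeneous.

(** * Random colourings *)

(** Cauchy-Schwarz against a constant, read off from the sum of all [(a i - a j) ^+ 2] being
    nonnegative. *)
Lemma sqr_sum_le (R : realDomainType) (I : finType) (A : {set I}) (a : I -> R) :
  (\sum_(i in A) a i) ^+ 2 <= #|A|%:R * \sum_(i in A) a i ^+ 2.
Proof.
set s := \sum_(i in A) a i; set t := \sum_(i in A) _.
have : 0 <= \sum_(i in A) \sum_(j in A) (a i - a j) ^+ 2.
  by do 2![apply: sumr_ge0 => ? _]; rewrite sqr_ge0.
have -> : \sum_(i in A) \sum_(j in A) (a i - a j) ^+ 2
    = 2 * (#|A|%:R * t - s ^+ 2).
  have expand i : \sum_(j in A) (a i - a j) ^+ 2
      = #|A|%:R * a i ^+ 2 - 2 * s * a i + t.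
    transitivity (\sum_(j in A) (a i ^+ 2 - 2 * a i * a j + a j ^+ 2)).
      by apply: eq_bigr => j _; ring.
    rewrite big_split sumrB /= sumr_const -[_ *+ #|A|]mulr_natl -/t.
    by rewrite -(mulr_sumr _ _ _ (2 * a i)) -/s; ring.
  under eq_bigr do rewrite expand.
  rewrite big_split sumrB /= sumr_const -[t *+ _]mulr_natl.
  by rewrite -(mulr_sumr _ _ _ #|A|%:R) -/t -(mulr_sumr _ _ _ (2 * s)) -/s; ring.
by rewrite pmulr_rge0 // subr_ge0.
Qed.

Section FourCycles.
Variables (R : realFieldType) (V : finType) (g : V -> V -> R).

(** Expanding the square gives the number of four-cycles [i, j, i', j'], degenerate ones included,
    each weighted by the product of [g] over its four edges. *)
Definition four_cycles : R := \sum_j \sum_j' (\sum_i g i j * g i j') ^+ 2.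

(** Cauchy-Schwarz twice, first over [i] and then over the pairs [(j, j')]. After each application
    the summands are squares, so the sum may be extended from [S], respectively [T * T], to
    everything. *)
Lemma four_cycles_cut (S T : {set V}) :
  (\sum_(i in S) \sum_(j in T) g i j) ^+ 4 <= #|V|%:R ^+ 4 * four_cycles.
Proof.
pose D j j' := \sum_i g i j * g i j'.
pose n : R := #|V|%:R.
have cardV (A : {set V}) : (#|A|%:R : R) <= n by rewrite ler_nat max_card.
have cs1 : (\sum_(i in S) \sum_(j in T) g i j) ^+ 2
    <= n * \sum_(j in T) \sum_(j' in T) D j j'.
  apply: le_trans (sqr_sum_le _ _) _.
  apply: (@le_trans _ _ (n * \sum_i (\sum_(j in T) g i j) ^+ 2)); last first.
    rewrite ler_wpM2l // le_eqVlt; apply/orP; left; apply/eqP.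
    rewrite /D; under [RHS]eq_bigr do rewrite exchange_big.
    rewrite [RHS]exchange_big; apply: eq_bigr => i _.
    rewrite expr2 mulr_suml; apply: eq_bigr => j _.
    by rewrite mulr_sumr.
  apply: ler_pM => //; first by apply: sumr_ge0 => ? _; rewrite sqr_ge0.
  by rewrite [leRHS](bigID (mem S)) lerDl sumr_ge0 // => ? _; rewrite sqr_ge0.
have cs2 : (\sum_(j in T) \sum_(j' in T) D j j') ^+ 2 <= n ^+ 2 * four_cycles.
  rewrite pair_big_dep /=.
  rewrite (eq_bigl (fun p => p \in setX T T)); last by case=> ? ?; rewrite in_setX.
  apply: le_trans (sqr_sum_le _ _) _; rewrite /four_cycles pair_big /=.
  apply: ler_pM => //; first by apply: sumr_ge0 => ? _; rewrite sqr_ge0.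
    by rewrite cardsX natrM expr2 ler_pM.
  by rewrite [leRHS](bigID (mem (setX T T))) lerDl sumr_ge0 // => ? _;
    rewrite sqr_ge0.
rewrite -/n (exprM _ 2 2) (le_trans (lerXn2r 2 _ _ cs1)) ?nnegrE ?sqr_ge0 //.
  by rewrite (le_trans _ cs1) ?sqr_ge0.
have -> : n ^+ 4 * four_cycles = n ^+ 2 * (n ^+ 2 * four_cycles) by ring.
by rewrite exprMn ler_wpM2l ?sqr_ge0.
Qed.

End FourCycles.

Section RandomColouring.
Variables (R : archiRealFieldType) (K : finType) (x : K -> R).
Hypothesis x_ge0 : forall a, 0 <= x a.
Hypothesis x_sum : \sum_a x a = 1.

(** The product measure: the probability of [phi] when each element of [E] is coloured independently
    with distribution [x]. Expectations are finite sums against it. *)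
Definition weight (E : finType) (phi : {ffun E -> K}) : R := \prod_e x (phi e).

Lemma weight_ge0 (E : finType) (phi : {ffun E -> K}) : 0 <= weight phi.
Proof. by apply: prodr_ge0. Qed.

Lemma expectation_prod (E : finType) (u : E -> K -> R) :
  \sum_(phi : {ffun E -> K}) weight phi * \prod_e u e (phi e)
    = \prod_e \sum_a x a * u e a.
Proof.
by rewrite bigA_distr_bigA; apply: eq_bigr => phi _; rewrite -big_split.
Qed.

Lemma weight_sum (E : finType) : \sum_(phi : {ffun E -> K}) weight phi = 1.
Proof.
rewrite -(bigA_distr_bigA (fun _ => x)) big1 // => e _; exact: x_sum.
Qed.

(** If [F] exceeded [B] on every colouring of positive weight, so would its mean. Positive weight is
    kept in the conclusion because the ev and ee Lagrangians only control colours of positive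
    weight. *)
Lemma first_moment (E : finType) (F : {ffun E -> K} -> R) (B : R) :
  \sum_phi weight phi * F phi <= B ->
  exists phi : {ffun E -> K}, (forall e, 0 < x (phi e)) /\ F phi <= B.
Proof.
move=> le_B.
have [phi /andP[w_gt0 FB]|none] := pickP
  (fun phi : {ffun E -> K} => (0 < weight phi) && (F phi <= B)).
  exists phi; split=> // e; rewrite lt0r x_ge0 andbT.
  by move: w_gt0; rewrite lt0r => /andP[/prodf_neq0->].
have [phi w_gt0|w0] := pickP (fun phi : {ffun E -> K} => 0 < weight phi);
    last first.
  have := weight_sum E; rewrite big1 => [/eqP|phi _].
    by rewrite eq_sym oner_eq0.
  by apply/eqP; rewrite eq_le weight_ge0 leNgt w0.
have lt_F psi : 0 < weight psi -> B < F psi.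
  by move=> w; have := none psi; rewrite w /= => /negbT; rewrite -ltNge.
suff : \sum_(phi : {ffun E -> K}) weight phi * B < \sum_phi weight phi * F phi.
  by rewrite -mulr_suml weight_sum mul1r ltNge le_B.
rewrite (bigD1 phi) // [ltRHS](bigD1 phi) //= ltr_leD ?ltr_pM2l ?lt_F //.
apply: ler_sum => psi _; have [w0|] := eqVneq (weight psi) 0.
  by rewrite w0 !mul0r.
move=> w0; rewrite ler_wpM2l ?weight_ge0 // ltW // lt_F //.
by rewrite lt0r w0 weight_ge0.
Qed.

Let centred (E : eqType) (c : K) (b : rel E) (i j : E) (a : K) : R :=
  (b i j)%:R * ((a == c)%:R - x c).

(** The four ordered pairs are distinct, hence coloured independently, and the factor at [(i, j)]
    has mean zero. *)
Lemma expectation_four_cycle (V : finType) (b : rel V) (c : K) (i i' j j' : V) :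
  i != i' -> j != j' ->
  \sum_(phi : {ffun V * V -> K}) weight phi *
    (centred c b i j (phi (i, j)) * centred c b i j' (phi (i, j')) *
     (centred c b i' j (phi (i', j)) * centred c b i' j' (phi (i', j')))) = 0.
Proof.
move=> ii' jj'.
(* Padding with 1 turns a factor that depends on a single coordinate into a product over all
   coordinates, as [expectation_prod] requires. *)
pose at_ (p e : V * V) a := if e == p then centred c b p.1 p.2 a else 1.
have at_prod p (phi : {ffun V * V -> K}) :
    \prod_e at_ p e (phi e) = centred c b p.1 p.2 (phi p).
  by rewrite /at_ -big_mkcond big_pred1_eq.
pose u e a := at_ (i, j) e a * at_ (i, j') e a *
  (at_ (i', j) e a * at_ (i', j') e a).
transitivity (\sum_(phi : {ffun V * V -> K}) weight phi * \prod_e u e (phi e)).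
  by apply: eq_bigr => phi _; rewrite !big_split /= !at_prod.
rewrite expectation_prod (bigD1 (i, j)) //=.
rewrite [X in X * _](_ : _ = 0) ?mul0r //.
rewrite /u /at_ eqxx !xpair_eqE !eqxx (negPf ii') (negPf jj') /=.
under eq_bigr do rewrite !mulr1 mulrCA.
rewrite -mulr_sumr; under eq_bigr do rewrite mulrBr.
rewrite sumrB -mulr_suml x_sum mul1r (bigD1 c) //= eqxx mulr1 big1.
  by rewrite addr0 subrr mulr0.
by move=> a /negPf->; rewrite mulr0.
Qed.

Lemma centred_le1 (E : eqType) c (b : rel E) i j a : `|centred c b i j a| <= 1.
Proof.
have x_le1 : x c <= 1 by rewrite -x_sum (bigD1 c) //= lerDl sumr_ge0.
have := x_ge0 c.
rewrite /centred; case: (b i j); rewrite ?mul0r ?normr0 ?ler01 // mul1r.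
by rewrite ler_norml; case: (_ == _); rewrite /=; lra.
Qed.

(** Only the degenerate cycles, with [i = i'] or [j = j'], have nonzero mean. There are at most
    [2 * n ^ 3] of them, each contributing at most 1. *)
Lemma expectation_four_cycles (V : finType) (b : rel V) (c : K) :
  \sum_(phi : {ffun V * V -> K}) weight phi *
    four_cycles (fun i j => centred c b i j (phi (i, j))) <= 2 * #|V|%:R ^+ 3.
Proof.
pose F (phi : {ffun V * V -> K}) j j' i i' : R :=
  centred c b i j (phi (i, j)) * centred c b i j' (phi (i, j')) *
  (centred c b i' j (phi (i', j)) * centred c b i' j' (phi (i', j'))).
have -> : \sum_(phi : {ffun V * V -> K}) weight phi *
    four_cycles (fun i j => centred c b i j (phi (i, j))) =
  \sum_j \sum_j' \sum_i \sum_i' \sum_phi weight phi * F phi j j' i i'.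
  under eq_bigr => phi _.
    rewrite /four_cycles mulr_sumr; under eq_bigr => j _.
      rewrite mulr_sumr; under eq_bigr => j' _.
        rewrite expr2 mulr_suml mulr_sumr; under eq_bigr => i _.
          rewrite mulr_sumr mulr_sumr; over.
        over.
      over.
    over.
  rewrite exchange_big; apply: eq_bigr => j _.
  rewrite exchange_big; apply: eq_bigr => j' _.
  rewrite exchange_big; apply: eq_bigr => i _.
  by rewrite exchange_big.
apply: (@le_trans _ _ (\sum_(j : V) \sum_(j' : V) \sum_(i : V) \sum_(i' : V)
    ((i == i')%:R + (j == j')%:R))).
  apply: ler_sum => j _; apply: ler_sum => j' _.
  apply: ler_sum => i _; apply: ler_sum => i' _.
  have F_le1 phi : F phi j j' i i' <= 1.
    have mul_le1 (u v : R) : `|u| <= 1 -> `|v| <= 1 -> `|u * v| <= 1.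
      by move=> u1 v1; rewrite normrM mulr_ile1.
    apply: le_trans (ler_norm _) _.
    by apply: (mul_le1); apply: (mul_le1); exact: centred_le1.
  have le1 : \sum_phi weight phi * F phi j j' i i' <= 1.
    rewrite -(weight_sum (V * V)%type); apply: ler_sum => phi _.
    by rewrite ler_piMr ?weight_ge0.
  have [ii'|ii'] := eqVneq i i'; first by rewrite (le_trans le1) // lerDl.
  have [jj'|jj'] := eqVneq j j'; first by rewrite (le_trans le1) // lerDr.
  by rewrite (expectation_four_cycle b c ii' jj') addr0.
have delta_sum (v : V) : \sum_w (v == w)%:R = 1 :> R.
  by rewrite (bigD1 v) //= eqxx big1 ?addr0 // => w /negPf; rewrite eq_sym => ->.
rewrite le_eqVlt; apply/orP; left; apply/eqP.
set n : R := #|V|%:R; have nE (w : R) : w *+ #|V| = n * w by rewrite mulr_natl.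
transitivity (\sum_(j : V) \sum_(j' : V) (n + n ^+ 2 * (j == j')%:R)).
  apply: eq_bigr => j _; apply: eq_bigr => j' _.
  under eq_bigr do rewrite big_split /= delta_sum sumr_const.
  by rewrite sumr_const !nE; ring.
under eq_bigr do rewrite big_split /= -mulr_sumr delta_sum sumr_const.
by rewrite sumr_const !nE; ring.
Qed.

Lemma random_colouring (e : R) (n0 : nat) : 0 < e ->
  exists (N : nat) (phi : 'I_N -> 'I_N -> K),
  [/\ (n0 <= N)%N, forall i j, 0 < x (phi i j) &
    forall c, cut_close [set: 'I_N] [set: 'I_N]
      (fun i j => (i < j)%N && (phi i j == c)) (fun i j => (i < j)%N)
      (x c) (e * N%:R ^+ 2)].
Proof.
move=> e_gt0.
(* Chosen so that [N ^ 4] times the bound [2 * #|K| * N ^ 3] on the four-cycles is at most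
   [(e * N ^ 2) ^ 4]. Adding up the four-cycles of all colours before taking the first moment makes
   one colouring serve every colour. *)
pose N := (n0 + (Num.truncn (2 * #|K|%:R / e ^+ 4)).+1)%N.
have N_large : 2 * #|K|%:R <= e ^+ 4 * N%:R.
  rewrite [leRHS]mulrC -ler_pdivrMr ?exprn_gt0 // ltW //.
  by rewrite (lt_le_trans (truncnS_gt _)) // ler_nat leq_addl.
pose g c (phi : {ffun 'I_N * 'I_N -> K}) i j :=
  centred c (fun i j : 'I_N => (i < j)%N) i j (phi (i, j)).
have [|phi [phi_pos le_phi]] := @first_moment ('I_N * 'I_N)%type
    (fun phi => \sum_c four_cycles (g c phi)) (#|K|%:R * (2 * N%:R ^+ 3)).
  under eq_bigr do rewrite mulr_sumr; rewrite exchange_big /=.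
  rewrite -sum1_card natr_sum mulr_suml; apply: ler_sum => c _.
  rewrite mul1r; apply: le_trans (expectation_four_cycles _ _) _.
  by rewrite card_ord.
exists N, (fun i j => phi (i, j)); split; first exact: leq_addr.
  by move=> i j; exact: phi_pos.
move=> c S T _ _.
rewrite (eq_bigr (fun i => \sum_(j in T) g c phi i j)); last first.
  move=> i _; apply: eq_bigr => j _; rewrite /g /centred.
  by case: (i < j)%N; rewrite /= ?mulr1 ?mul1r // mulr0 mul0r subr0.
have N_ge0 : 0 <= e * N%:R ^+ 2 by rewrite mulr_ge0 ?sqr_ge0 // ltW.
rewrite -(@ler_pXn2r _ 4) ?nnegrE // -normrX ger0_norm ?exprn_even_ge0 //.
apply: le_trans (four_cycles_cut _ _ _) _; rewrite card_ord.
have le_c : four_cycles (g c phi) <= #|K|%:R * (2 * N%:R ^+ 3).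
  apply: le_trans le_phi; rewrite [leRHS](bigD1 c) //= lerDl.
  by do 3![apply: sumr_ge0 => ? _]; rewrite sqr_ge0.
have -> : (e * N%:R ^+ 2) ^+ 4 = N%:R ^+ 4 * (e ^+ 4 * N%:R * N%:R ^+ 3) by ring.
rewrite ler_wpM2l ?exprn_ge0 // (le_trans le_c) // mulrCA mulrA.
by rewrite ler_wpM2r ?exprn_ge0.
Qed.

End RandomColouring.

(** * Coloured 3-graphs *)

Section PaletteTypes.
Variable P : palette.
Local Notation Phi := (colours P).
Implicit Types (a b c : Phi) (s : bool * bool * bool).

(* The order type of a triple (x, y, z) is (x < y, y < z, x < z). For such a
   triple with a, b, c the colours of xy, yz, xz, the triple of colours read in
   increasing order of the vertices has to be in the palette. The two
   intransitive order types do not occur and are allowed every colouring. *)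
Definition allowed s a b c : bool :=
  match s with
  | (true, true, true) => in_palette a c b
  | (true, false, true) => in_palette c a b
  | (true, false, false) => in_palette c b a
  | (false, true, true) => in_palette a b c
  | (false, true, false) => in_palette b a c
  | (false, false, false) => in_palette b c a
  | _ => true
  end.

Definition transitive_type s : bool :=
  match s with (true, true, false) | (false, false, true) => false | _ => true end.

Variable R : realType.
Implicit Types (x : Phi -> R) (t : R).

Definition pair_sum x s a b : R := \sum_(c | allowed s a b c) x c.
Definition colour_sum x s b : R := \sum_a \sum_(c | allowed s a b c) x a * x c.
Definition palette_sum x s : R :=
  \sum_a \sum_b \sum_(c | allowed s a b c) x a * x b * x c.

Lemma le_lambda_pair t x a b :
  (forall s, transitive_type s -> t <= pair_sum x s a b) <->
  t <= lambda_pair x a b.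
Proof.
rewrite /lambda_pair !le_min; split=> [H|].
  by rewrite (H (false, true, true)) // (H (false, true, false)) //
    (H (true, true, true)) // (H (false, false, false)) //
    (H (true, false, true)) // (H (true, false, false)).
by move=> /and5P[h1 h2 h3 h4 /andP[h5 h6]] [[[] []] []].
Qed.

Let swap x (r : Phi -> Phi -> bool) :
  \sum_c \sum_(d | r c d) x c * x d = \sum_d \sum_(c | r c d) x d * x c.
Proof.
rewrite (exchange_big_dep xpredT) //=; apply: eq_bigr => d _.
by apply: eq_bigr => c _; rewrite mulrC.
Qed.

(** The three order types with [y < z] place [x] last, between or first, so the colour of [yz]
    becomes the first, second or third entry of the triple. These are the three sums in
    [lambda_colour], up to the names of the summed colours. *)
Lemma lambda_colour_ge t x b :
  (forall s, transitive_type s -> s.1.2 -> t <= colour_sum x s b) ->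
  t <= lambda_colour x b.
Proof.
move=> H; rewrite /lambda_colour !le_min.
apply/and3P; split; [|rewrite swap|].
- exact: (H (false, true, false)).
- by rewrite -swap; exact: (H (false, true, true)).
- exact: (H (true, true, true)).
Qed.

Lemma lambda_colour_le x s b :
  transitive_type s -> lambda_colour x b <= colour_sum x s b.
Proof.
have := lexx (lambda_colour x b); rewrite {2}/lambda_colour !le_min.
by move=> /and3P[h1 h2 h3]; case: s => [[[] []] []] // _; rewrite /colour_sum -swap.
Qed.

Lemma palette_sumE x s : transitive_type s -> palette_sum x s = lambda_vvv x.
Proof.
have swap12 (F : Phi -> Phi -> Phi -> R) :
    \sum_a \sum_b \sum_c F a b c = \sum_a \sum_b \sum_c F b a c.
  by rewrite exchange_big.
have swap23 (F : Phi -> Phi -> Phi -> R) :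
    \sum_a \sum_b \sum_c F a b c = \sum_a \sum_b \sum_c F a c b.
  by apply: eq_bigr => a _; rewrite exchange_big.
have expand (r : Phi -> Phi -> Phi -> bool) :
    \sum_a \sum_b \sum_(c | r a b c) x a * x b * x c =
    \sum_a \sum_b \sum_c (r a b c)%:R * (x a * x b * x c).
  apply: eq_bigr => a _; apply: eq_bigr => b _; rewrite big_mkcond.
  by apply: eq_bigr => c _; case: (r a b c); rewrite ?mul1r ?mul0r.
rewrite /palette_sum /lambda_vvv !expand.
have fin (F G : Phi -> Phi -> Phi -> R) : (forall a b c, F a b c = G a b c) ->
    \sum_a \sum_b \sum_c F a b c = \sum_a \sum_b \sum_c G a b c.
  by move=> FG; do 3![apply: eq_bigr => ? _].
case: s => [[[] []] []] // _ /=.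
- by rewrite swap23; apply: fin => a b c; ring.
- by rewrite swap12 swap23 swap12 swap23; apply: fin => a b c; ring.
- by rewrite swap12 swap23 swap12; apply: fin => a b c; ring.
- by rewrite swap12; apply: fin => a b c; ring.
- by rewrite swap12 swap23; apply: fin => a b c; ring.
Qed.

End PaletteTypes.

Definition order_type (V : Type) (r : V -> nat) (x y z : V) : bool * bool * bool :=
  ((r x < r y)%N, (r y < r z)%N, (r x < r z)%N).

(** A linear order is given as an injection into [nat], so that restricting it to a subhypergraph is
    composition with the embedding. *)
Definition coloured (P : palette) (H : graph3) (r : vertex H -> nat)
    (col : vertex H -> vertex H -> colours P) : Prop :=
  [/\ injective r, forall x y, col x y = col y x &
   forall x y z, (r x < r y)%N -> (r y < r z)%N -> [set x; y; z] \in edges H ->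
     in_palette (col x y) (col x z) (col y z)].

Definition colourable (P : palette) (H : graph3) : Prop :=
  exists r col, @coloured P H r col.

Lemma colourable_sub (P : palette) (G H : graph3) :
  subhypergraph G H -> colourable P H -> colourable P G.
Proof.
move=> [f f_inj fE] [r [col [r_inj col_sym colE]]].
exists (r \o f), (fun x y => col (f x) (f y)); split=> //=.
- exact: inj_comp.
- by move=> x y z xy yz /fE; rewrite !imsetU !imset_set1 => /colE; apply.
Qed.

Lemma family_free_colourable (P : palette) (H : graph3) :
  family_free (fun G => ~ colourable P G) H <-> colourable P H.
Proof.
split=> [free|colH G nG /colourable_sub/(_ colH)//].
apply: contrapT => nH; apply: (free H nH); exists id => // e.
by rewrite imset_id.
Qed.

Section SetTriples.
Variable V : finType.
Implicit Types (x y z : V).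

Lemma set3C12 x y z : [set x; y; z] = [set y; x; z].
Proof. by rewrite (setUC [set x]). Qed.

Lemma set3C23 x y z : [set x; y; z] = [set x; z; y].
Proof. by rewrite setUAC. Qed.

Lemma card3_distinct x y z : #|[set x; y; z]| = 3%N -> [&& x != y, y != z & x != z].
Proof.
move=> c3; apply/and3P; split; apply/eqP => e; move: c3; rewrite e.
- by rewrite setUid cards2; case: (_ != _).
- by rewrite -setUA setUid cards2; case: (_ != _).
- by rewrite setUAC setUid cards2; case: (_ != _).
Qed.

Lemma card_distinct3 x y z : [&& x != y, y != z & x != z] -> #|[set x; y; z]| = 3%N.
Proof.
by move=> /and3P[xy yz xz]; rewrite setUC cardsU1 !inE negb_or cards2 xy
  (eq_sym z) xz (eq_sym z) yz.
Qed.

Variables (r : V -> nat).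

Lemma sorted_triple_unique x y z x' y' z' :
  (r x < r y < r z)%N -> (r x' < r y' < r z')%N ->
  [set x; y; z] = [set x'; y'; z'] -> [/\ x = x', y = y' & z = z'].
Proof.
move=> /andP[xy yz] /andP[xy' yz'] /setP e.
have := e x; have := e y; have := e z; rewrite !inE !eqxx ?orbT /=.
move=> /esym/orP[/orP[]|]/eqP ez /esym/orP[/orP[]|]/eqP ey
  /esym/orP[/orP[]|]/eqP ex; subst => //; exfalso; lia.
Qed.

End SetTriples.

Section ColouredEdges.
Variables (P : palette) (H : graph3) (r : vertex H -> nat).
Variable col : vertex H -> vertex H -> colours P.
Hypothesis colP : coloured r col.

(** Frees the palette condition from increasing enumerations: for each of the six orders the
    vertices are sorted and the symmetry of [col] is applied. *)
Lemma edge_allowed x y z : [set x; y; z] \in edges H ->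
  allowed (order_type r x y z) (col x y) (col y z) (col x z).
Proof.
case: colP => r_inj col_sym colE E.
have /and3P[xy yz xz] := card3_distinct (card_edge E).
have rN u v : u != v -> (r u < r v)%N = false -> (r v < r u)%N.
  by move=> uv; case: (ltngtP (r u) (r v)) => // /r_inj e; move: uv; rewrite e eqxx.
rewrite /order_type /allowed.
case lxy: (r x < r y)%N; case lyz: (r y < r z)%N; case lxz: (r x < r z)%N => //.
- exact: colE.
- rewrite (col_sym y z); apply: colE => //; last by rewrite set3C23.
  exact: rN.
- rewrite (col_sym x z) (col_sym y z); apply: colE => //; first exact: rN.
  by rewrite set3C12 set3C23.
- rewrite (col_sym x y); apply: colE => //; last by rewrite set3C12.
  exact: rN.
- rewrite (col_sym x y) (col_sym x z); apply: colE => //; first exact: rN.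
  by rewrite set3C23 set3C12.
- rewrite (col_sym x y) (col_sym x z) (col_sym y z); apply: colE => //; try exact: rN.
  by rewrite set3C12 set3C23 set3C12.
Qed.

End ColouredEdges.

Section PaletteGraph.
Variables (P : palette) (V : finType) (r : V -> nat) (col : V -> V -> colours P).

(** The largest edge set for which [col] is a palette colouring with respect to [r]. An edge is an
    unordered set, so the condition quantifies over its increasing enumerations, of which there is
    one when [r] is injective. *)
Definition palette_edges : {set {set V}} := [set e : {set V} | (#|e| == 3)%N &&
  [forall x, forall y, forall z, [&& (r x < r y)%N, (r y < r z)%N &
     e == [set x; y; z]] ==> in_palette (col x y) (col x z) (col y z)]].

Lemma card_palette_edges e : e \in palette_edges -> #|e| = 3%N.
Proof. by rewrite inE => /andP[/eqP]. Qed.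

Definition palette_graph : graph3 := Graph3 card_palette_edges.

Hypothesis r_inj : injective r.
Hypothesis col_sym : forall x y, col x y = col y x.

Lemma palette_graph_coloured : @coloured P palette_graph r col.
Proof.
split=> // x y z xy yz; rewrite inE => /andP[_ /forallP/(_ x)/forallP/(_ y)].
by move=> /forallP/(_ z); rewrite xy yz eqxx.
Qed.

Lemma allowed_edge x y z : [&& x != y, y != z & x != z] ->
  allowed (order_type r x y z) (col x y) (col y z) (col x z) ->
  [set x; y; z] \in edges palette_graph.
Proof.
have sorted u v w : (r u < r v)%N -> (r v < r w)%N ->
    in_palette (col u v) (col u w) (col v w) -> [set u; v; w] \in palette_edges.
  move=> uv vw ok; rewrite inE card_distinct3 /=; last first.
    by apply/and3P; split; apply: contraTneq isT => e; subst; lia.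
  apply/forallP => u'; apply/forallP => v'; apply/forallP => w'.
  apply/implyP => /and3P[uv' vw' /eqP e].
  have uvw : (r u < r v < r w)%N by rewrite uv.
  have uvw' : (r u' < r v' < r w')%N by rewrite uv'.
  by have [<- <- <-] := sorted_triple_unique uvw uvw' e.
have rN u v : u != v -> (r u < r v)%N = false -> (r v < r u)%N.
  by move=> uv; case: (ltngtP (r u) (r v)) => // /r_inj e; move: uv; rewrite e eqxx.
move=> /and3P[xy yz xz]; rewrite /order_type /allowed.
case lxy: (r x < r y)%N; case lyz: (r y < r z)%N; case lxz: (r x < r z)%N => ok.
- exact: sorted.
- by have := ltn_trans lxy lyz; rewrite lxz.
- rewrite set3C23; apply: sorted; rewrite // 1?(col_sym z y) //; exact: rN.
- rewrite set3C23 set3C12; apply: sorted; rewrite // ?(col_sym z x) ?(col_sym z y) //.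
  exact: rN.
- rewrite set3C12; apply: sorted; rewrite // ?(col_sym y x) //; exact: rN.
- rewrite set3C12 set3C23; apply: sorted; rewrite // ?(col_sym y x) ?(col_sym z x) //.
  exact: rN.
- by have := ltn_trans (rN _ _ yz lyz) (rN _ _ xy lxy); lia.
- rewrite set3C12 set3C23 set3C12; apply: sorted;
    rewrite ?(col_sym z y) ?(col_sym z x) ?(col_sym y x) //; exact: rN.
Qed.

End PaletteGraph.

(** * Edge counts as sums of indicators *)

Section CountingSums.
Variables (R : realType) (H : graph3).
Local Notation V := (vertex H).
Local Notation E x y z := ([set x; y; z] \in edges H).

Lemma card_triples (W : finType) (b : W -> W -> W -> bool) :
  #|[set t : W * W * W | let: (x, y, z) := t in b x y z]|%:R
    = \sum_x \sum_y \sum_z (b x y z)%:R :> R.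
Proof.
rewrite cardsE -sum1_card natr_sum pair_big pair_big /= big_mkcond.
by apply: eq_bigr => -[[x y] z] _; rewrite unfold_in /=; case: (b x y z).
Qed.

Lemma sum_in (W : finType) (A : {set W}) (F : W -> R) :
  \sum_(x in A) F x = \sum_x (x \in A)%:R * F x.
Proof.
rewrite big_mkcond; apply: eq_bigr => x _.
by case: (x \in A); rewrite ?mul1r ?mul0r.
Qed.

Lemma e_vvvE (X Y Z : {set V}) : (e_vvv X Y Z)%:R
  = \sum_(x in X) \sum_(y in Y) \sum_(z in Z) (E x y z)%:R :> R.
Proof.
rewrite /e_vvv card_triples sum_in; apply: eq_bigr => x _.
rewrite sum_in mulr_sumr; apply: eq_bigr => y _.
rewrite sum_in !mulr_sumr; apply: eq_bigr => z _.
by rewrite -!natrM !mulnb.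
Qed.

Lemma K_eeE (P Q : {set {set V}}) : #|K_ee P Q|%:R
  = \sum_x \sum_y \sum_z (([set x; y] \in P) && ([set y; z] \in Q))%:R :> R.
Proof. by rewrite -card_triples. Qed.

Lemma e_eeE (P Q : {set {set V}}) : (e_ee P Q)%:R
  = \sum_x \sum_y \sum_z
     [&& [set x; y] \in P, [set y; z] \in Q & E x y z]%:R :> R.
Proof.
rewrite -card_triples; congr _%:R; apply: eq_card => -[[x y] z].
by rewrite !inE andbA.
Qed.

Variable r : V -> nat.
Hypothesis r_inj : injective r.

(** Each unordered pair has exactly one increasing enumeration, so ordering by [r] avoids a factor
    2. *)
Lemma sum_pairs (P : {set {set V}}) (G : {set V} -> R) : P \subset pairs H ->
  \sum_(p in P) G p
    = \sum_y \sum_z ((r y < r z)%N && ([set y; z] \in P))%:R * G [set y; z].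
Proof.
move=> /subsetP sub; rewrite pair_big /=.
pose cond (yz : V * V) := (r yz.1 < r yz.2)%N && ([set yz.1; yz.2] \in P).
transitivity (\sum_(yz | cond yz) G [set yz.1; yz.2]); last first.
  rewrite big_mkcond; apply: eq_bigr => yz _; rewrite -/(cond yz).
  by case: (cond yz); rewrite ?mul1r ?mul0r.
rewrite [RHS](partition_big (fun yz => [set yz.1; yz.2]) (mem P)) /=; last first.
  by move=> yz /andP[].
apply: eq_bigr => p pP; have := sub p pP; rewrite inE => /cards2P[u [v [uv pE]]].
wlog uv_lt : u v uv pE / (r u < r v)%N.
  move=> H0; case: (ltngtP (r u) (r v)) => [lt|lt|/r_inj e].
  - exact: (H0 u v).
  - by apply: (H0 v u) => //; rewrite ?pE 1?eq_sym // setUC.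
  - by move: uv; rewrite e eqxx.
rewrite (big_pred1 (u, v)) /= => [|[y z]]; first by rewrite -pE.
rewrite pE /cond /= xpair_eqE.
apply/idP/idP => [/andP[/andP[yz _] /eqP/setP e]|/andP[/eqP-> /eqP->]]; last first.
  by rewrite uv_lt -pE pP eqxx.
have := e y; have := e z; rewrite !inE !eqxx orbT /=.
move=> /esym/orP[]/eqP ez /esym/orP[]/eqP ey; subst; rewrite ?eqxx //; lia.
Qed.

Lemma card_pairset (P : {set {set V}}) : P \subset pairs H ->
  #|P|%:R = \sum_y \sum_z ((r y < r z)%N && ([set y; z] \in P))%:R :> R.
Proof.
move=> sub; rewrite -sum1_card natr_sum (sum_pairs _ sub).
by apply: eq_bigr => y _; apply: eq_bigr => z _; rewrite mulr1.
Qed.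

Lemma e_evE (X : {set V}) (P : {set {set V}}) : P \subset pairs H ->
  (e_ev X P)%:R = \sum_(x in X) \sum_y \sum_z
     [&& (r y < r z)%N, [set y; z] \in P & E x y z]%:R :> R.
Proof.
move=> sub.
transitivity (\sum_(x in X) \sum_(p in P) (x |: p \in edges H)%:R : R).
  rewrite /e_ev cardsE -sum1_card natr_sum pair_big_dep /= big_mkcond [RHS]big_mkcond.
  apply: eq_bigr => -[x p] _; rewrite unfold_in /=.
  by case: (x \in X); case: (p \in P); case: (_ \in edges H).
apply: eq_bigr => x _; rewrite (sum_pairs _ sub).
apply: eq_bigr => y _; apply: eq_bigr => z _.
by rewrite setUA -natrM mulnb andbA.
Qed.

End CountingSums.

(** * Upper bound *)

Lemma sum_le_card (R : numDomainType) (I : finType) (F : I -> R) (C : R) :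
  0 <= C -> (forall a, F a <= C) -> \sum_a F a <= #|I|%:R * C.
Proof.
move=> C0 FC; rewrite -sum1_card natr_sum mulr_suml.
by apply: ler_sum => a _; rewrite mul1r.
Qed.

Section Configurations.
Variables (R : realType) (P : palette) (V : finType) (r : V -> nat).
Local Notation Phi := (colours P).
Variables (col : V -> V -> Phi) (x : Phi -> R) (e d : R).
Hypothesis col_sym : forall u v, col u v = col v u.

Lemma eq_tri (X Y Z : {set V}) (f g h f' g' h' : rel V) :
  f =2 f' -> g =2 g' -> h =2 h' -> tri R X Y Z f g h = tri R X Y Z f' g' h'.
Proof.
by move=> ff gg hh; do 3![apply: eq_bigr => ? _]; rewrite ff gg hh.
Qed.

Lemma homogeneous_rot X Y Z :
  homogeneous col x e X Y Z -> homogeneous col x e Y Z X.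
Proof.
move=> H a b c; have := H c a b; rewrite tri_rot.
rewrite (@eq_tri Y Z X _ _ _ (fun u v => col u v == a) (fun u v => col u v == b)
  (fun u v => col u v == c)) //; try by move=> u v; rewrite col_sym.
set T := tri _ _ _ _ _ _ _.
have -> : x c * x a * x b * (#|X|%:R * #|Y|%:R * #|Z|%:R)
    = x a * x b * x c * (#|Y|%:R * #|Z|%:R * #|X|%:R) by ring.
by have -> : #|X|%:R * #|Y|%:R * #|Z|%:R = #|Y|%:R * #|Z|%:R * #|X|%:R :> R by ring.
Qed.

Lemma homogeneous_flip X Y Z :
  homogeneous col x e X Y Z -> homogeneous col x e Z Y X.
Proof.
move=> H a b c; have := H b a c; rewrite tri_flip.
rewrite (@eq_tri Z Y X _ _ _ (fun u v => col u v == a) (fun u v => col u v == b)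
  (fun u v => col u v == c)) //; try by move=> u v; rewrite col_sym.
set T := tri _ _ _ _ _ _ _.
have -> : x b * x a * x c * (#|X|%:R * #|Y|%:R * #|Z|%:R)
    = x a * x b * x c * (#|Z|%:R * #|Y|%:R * #|X|%:R) by ring.
by have -> : #|X|%:R * #|Y|%:R * #|Z|%:R = #|Z|%:R * #|Y|%:R * #|X|%:R :> R by ring.
Qed.

(** [X], [Y], [Z] are the arguments in the order in which the density condition takes them; [s]
    records how they lie in the vertex order. The six transitive [s] are obtained by permuting one
    triple [A < B < C]. *)
Definition configuration s (X Y Z : {set V}) : Prop :=
  [/\ [/\ d <= #|X|%:R, d <= #|Y|%:R & d <= #|Z|%:R],
      homogeneous col x e X Y Z,
      [/\ [disjoint X & Y], [disjoint Y & Z] & [disjoint X & Z]]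
    & forall u v w, u \in X -> v \in Y -> w \in Z -> order_type r u v w = s].

Lemma configuration_exists A B C s : transitive_type s ->
  homogeneous col x e A B C ->
  [/\ d <= #|A|%:R, d <= #|B|%:R & d <= #|C|%:R] -> 0 < d ->
  {in A & B, forall u v, (r u < r v)%N} ->
  {in B & C, forall u v, (r u < r v)%N} ->
  exists X Y Z, configuration s X Y Z.
Proof.
move=> tr hABC [dA dB dC] d_gt0 AB BC.
have hBCA := homogeneous_rot hABC; have hCAB := homogeneous_rot hBCA.
have hCBA := homogeneous_flip hABC; have hACB := homogeneous_flip hBCA.
have hBAC := homogeneous_flip hCAB.
have [v0 v0B] : exists v, v \in B.
  by apply/set0Pn; rewrite -card_gt0 -(ltr0n R) (lt_le_trans d_gt0).
have AC : {in A & C, forall u v, (r u < r v)%N}.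
  by move=> u v uA vC; apply: ltn_trans (AB u v0 uA v0B) (BC v0 v v0B vC).
have disj (X Y : {set V}) : {in X & Y, forall u v, (r u < r v)%N} ->
    [disjoint X & Y] /\ [disjoint Y & X].
  move=> XY; suff XY0 : [disjoint X & Y] by split=> //; rewrite disjoint_sym.
  apply/pred0P => u /=; apply/negP => /andP[uX uY].
  by have := XY u u uX uY; rewrite ltnn.
have [dAB dBA] := disj _ _ AB; have [dBC dCB] := disj _ _ BC.
have [dAC dCA] := disj _ _ AC.
have N u v : (r u < r v)%N -> (r v < r u)%N = false by lia.
case: s tr => [[[] []] []] // _.
- exists A, B, C; split=> // u v w uX vY wZ.
  by rewrite /order_type (AB u v uX vY) (BC v w vY wZ)
    (AC u w uX wZ).
- exists A, C, B; split=> // u v w uX vY wZ.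
  by rewrite /order_type (AC u v uX vY) (N _ _ (BC w v wZ vY))
    (AB u w uX wZ).
- exists B, C, A; split=> // u v w uX vY wZ.
  by rewrite /order_type (BC u v uX vY) (N _ _ (AC w v wZ vY))
    (N _ _ (AB w u wZ uX)).
- exists B, A, C; split=> // u v w uX vY wZ.
  by rewrite /order_type (N _ _ (AB v u vY uX)) (AC v w vY wZ)
    (BC u w uX wZ).
- exists C, A, B; split=> // u v w uX vY wZ.
  by rewrite /order_type (N _ _ (AC v u vY uX)) (AB v w vY wZ)
    (N _ _ (BC w u wZ uX)).
- exists C, B, A; split=> // u v w uX vY wZ.
  by rewrite /order_type (N _ _ (BC v u vY uX)) (N _ _ (AB w v wZ vY))
    (N _ _ (AC w u wZ uX)).
Qed.

Hypothesis e_ge0 : 0 <= e.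

Lemma colour_count X Y Z (w : Phi -> Phi -> Phi -> bool) :
  homogeneous col x e X Y Z ->
  `|\sum_(u in X) \sum_(v in Y) \sum_(z in Z)
      (w (col u v) (col v z) (col u z))%:R
    - (\sum_a \sum_b \sum_(c | w a b c) x a * x b * x c) *
      (#|X|%:R * #|Y|%:R * #|Z|%:R)|
  <= #|{: Phi}|%:R ^+ 3 * e * (#|X|%:R * #|Y|%:R * #|Z|%:R).
Proof.
move=> H; set n3 := _ * _ * _; pose T a b c := tri R X Y Z
  (fun u v => col u v == a) (fun u v => col u v == b) (fun u v => col u v == c).
have -> : \sum_(u in X) \sum_(v in Y) \sum_(z in Z)
      (w (col u v) (col v z) (col u z))%:R
    = \sum_a \sum_b \sum_(c | w a b c) T a b c.
  have pick (F : Phi -> R) a0 : \sum_a (a0 == a)%:R * F a = F a0.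
    rewrite (bigD1 a0) //= eqxx mul1r big1 ?addr0 // => a /negPf.
    by rewrite eq_sym => ->; rewrite mul0r.
  transitivity (\sum_(u in X) \sum_(v in Y) \sum_(z in Z)
      \sum_a \sum_b \sum_c (col u v == a)%:R * ((col v z == b)%:R *
        ((col u z == c)%:R * (w a b c)%:R)) : R).
    do 3![apply: eq_bigr => ? _]; symmetry.
    under eq_bigr => a _.
      under eq_bigr => b _ do rewrite -!mulr_sumr pick.
      by rewrite -mulr_sumr pick; over.
    by rewrite pick.
  under eq_bigr => u _.
    under eq_bigr => v _.
      rewrite exchange_big; under eq_bigr => a _.
        rewrite exchange_big; under eq_bigr => b _ do rewrite exchange_big.
        over.
      over.
    rewrite exchange_big; under eq_bigr => a _.
      rewrite exchange_big; under eq_bigr => b _ do rewrite exchange_big.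
      over.
    over.
  rewrite exchange_big; apply: eq_bigr => a _ /=.
  rewrite exchange_big; apply: eq_bigr => b _ /=.
  rewrite exchange_big [RHS]big_mkcond; apply: eq_bigr => c _ /=.
  rewrite /T /tri; case: (w a b c); last first.
    by do 3![apply: big1 => ? _]; rewrite !mulr0.
  by do 3![apply: eq_bigr => ? _]; rewrite mulr1 mulrA.
rewrite mulr_suml -sumrB; apply: le_trans (ler_norm_sum _ _ _) _.
have en0 : 0 <= e * n3 by rewrite !mulr_ge0.
have -> : #|{: Phi}|%:R ^+ 3 * e * n3
  = #|{: Phi}|%:R * (#|{: Phi}|%:R * (#|{: Phi}|%:R * (e * n3))) by ring.
apply: sum_le_card => [|a]; first by rewrite !mulr_ge0.
rewrite mulr_suml -sumrB; apply: le_trans (ler_norm_sum _ _ _) _.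
apply: sum_le_card => [|b]; first by rewrite !mulr_ge0.
rewrite mulr_suml -sumrB; apply: le_trans (ler_norm_sum _ _ _) _.
rewrite big_mkcond; apply: sum_le_card => // c; case: ifP => // _; exact: H.
Qed.

End Configurations.

Section UpperBound.
Variables (R : realType) (P : palette) (H : graph3) (r : vertex H -> nat).
Local Notation V := (vertex H).
Local Notation Phi := (colours P).
Variables (col : V -> V -> Phi) (x : Phi -> R).
Hypothesis colP : coloured r col.
Hypothesis x01 : forall a, 0 <= x a <= 1.
Hypothesis x_sum : \sum_a x a = 1.

Lemma sum_in2 (W : finType) (A B : {set W}) (F : W -> W -> bool) :
  \sum_(u in A) \sum_(v in B) (F u v)%:R
    = \sum_u \sum_v [&& u \in A, v \in B & F u v]%:R :> R.
Proof.
rewrite sum_in; apply: eq_bigr => u _; rewrite sum_in mulr_sumr.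
by apply: eq_bigr => v _; rewrite -!natrM !mulnb.
Qed.

Implicit Types (X Y Z : {set V}) (a b c : Phi).

(** The pairs of colour [a] between [X] and [Y], in the form in which the ev and ee conditions are
    tested. *)
Definition link (X Y : {set V}) (a : Phi) : {set {set V}} :=
  [set p | [exists u in X, exists v in Y, (col u v == a) && (p == [set u; v])]].

Lemma link_pairs X Y a : [disjoint X & Y] -> link X Y a \subset pairs H.
Proof.
move=> dXY; apply/subsetP => p; rewrite !inE.
move=> /exists_inP[u uX /exists_inP[v vY /andP[_ /eqP->]]].
by rewrite cards2 (contraTneq _ uX) // => ->; rewrite (disjointFl dXY).
Qed.

Lemma mem_link X Y a u v : [disjoint X & Y] ->
  ([set u; v] \in link X Y a)
    = (col u v == a) && ((u \in X) && (v \in Y) || (u \in Y) && (v \in X)).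
Proof.
case: colP => _ col_sym _ dXY; rewrite inE; apply/idP/idP; last first.
  case/andP=> uva /orP[/andP[uX vY]|/andP[uY vX]].
    apply/exists_inP; exists u => //; apply/exists_inP; exists v => //.
    by rewrite uva eqxx.
  apply/exists_inP; exists v => //; apply/exists_inP; exists u => //.
  by rewrite col_sym uva setUC eqxx.
move=> /exists_inP[u' uX /exists_inP[v' vY /andP[uva /eqP/setP e]]].
have uv' : u' != v' by rewrite (contraTneq _ uX) // => ->; rewrite (disjointFl dXY).
have := e u; have := e v; have := e u'; have := e v'; rewrite !inE !eqxx ?orbT /=.
move=> /orP[]/eqP e1 /orP[]/eqP e2; subst; rewrite ?eqxx in uv' => //.
  by rewrite col_sym uva uX vY orbT.
by rewrite uva uX vY.
Qed.

Variables (e d : R) (s : bool * bool * bool) (X Y Z : {set V}).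
Hypothesis e_ge0 : 0 <= e.
Hypothesis d_gt0 : 0 < d.
Hypothesis conf : configuration r col x e d s X Y Z.
Variables (D eta k : R).
Hypothesis D01 : 0 <= D <= 1.
Hypothesis e_small : #|{: Phi}|%:R ^+ 3 * e <= k.
Hypothesis eta_small : eta * #|V|%:R ^+ 3 <= k * d ^+ 3.

Let n3 : R := #|X|%:R * #|Y|%:R * #|Z|%:R.

Lemma tolerance_ge0 : 0 <= k.
Proof. by apply: le_trans e_small; rewrite mulr_ge0 ?exprn_ge0. Qed.

Lemma size_gt0 : 0 < n3.
Proof.
case: conf => -[dX dY dZ] _ _ _.
by rewrite !mulr_gt0 ?(lt_le_trans d_gt0).
Qed.

Lemma error_small : eta * #|V|%:R ^+ 3 <= k * n3.
Proof.
apply: le_trans eta_small _; rewrite ler_wpM2l ?tolerance_ge0 //.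
case: conf => -[dX dY dZ] _ _ _; rewrite exprS expr2 mulrA /n3.
by have d0 := ltW d_gt0; rewrite !ler_pM ?mulr_ge0.
Qed.

Lemma count_close (w : Phi -> Phi -> Phi -> bool) :
  `|\sum_(u in X) \sum_(v in Y) \sum_(z in Z)
      (w (col u v) (col v z) (col u z))%:R
    - (\sum_a \sum_b \sum_(c | w a b c) x a * x b * x c) * n3| <= k * n3.
Proof.
case: conf => _ hom _ _; apply: le_trans (colour_count e_ge0 _ hom) _.
by rewrite ler_wpM2r // ltW // size_gt0.
Qed.

(** [S1] counts the tested triples and [S2] bounds the edges among them. Dividing by [n3] leaves
    three errors of size [k]: one for each count and one for the [eta] term. *)
Lemma density_transfer (w1 w2 S1 S2 : R) :
  `|S1 - w1 * n3| <= k * n3 -> `|S2 - w2 * n3| <= k * n3 ->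
  D * S1 - eta * #|V|%:R ^+ 3 <= S2 -> D * w1 <= w2 + 3 * k.
Proof.
rewrite !ler_norml => /andP[h1 _] /andP[_ h2] h3.
rewrite -(ler_pM2r size_gt0); have := error_small; have := size_gt0.
case/andP: D01 => D0 D1 n0 err.
have k0 : 0 <= k * n3 by rewrite mulr_ge0 ?tolerance_ge0 ?(ltW n0).
have : D * (w1 * n3 - k * n3) <= D * S1 by apply: ler_wpM2l => //; lra.
have : D * (k * n3) <= k * n3 by rewrite ler_piMl.
by lra.
Qed.

Lemma upper_vvv : uniformly_dense vvv D eta H ->
  D <= palette_sum x s + 3 * k.
Proof.
move=> dense; rewrite -[D]mulr1.
apply: (density_transfer (S1 := n3) _ (count_close (allowed s))).
  by rewrite mul1r subrr normr0 mulr_ge0 ?tolerance_ge0 // ltW // size_gt0.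
have -> : D * n3 = D * #|X|%:R * #|Y|%:R * #|Z|%:R by rewrite /n3; ring.
apply: le_trans (dense X Y Z) _.
rewrite e_vvvE; apply: ler_sum => u uX; apply: ler_sum => v vY.
apply: ler_sum => z zZ; rewrite ler_nat; case E: (_ \in edges H) => //.
have [_ _ _ types] := conf.
by have := edge_allowed colP E; rewrite types // => ->.
Qed.

(** Tests the condition on [X] and the pairs of colour [b] between [Y] and [Z]. The assumption on
    [s] puts [Y] before [Z], so the increasing enumerations of these pairs run over [Y * Z]. *)
Lemma upper_ev b : uniformly_dense ev D eta H -> s.1.2 ->
  D * x b <= x b * colour_sum x s b + 3 * k.
Proof.
move=> dense s2; have [_ _ [_ dYZ _] types] := conf.
have [r_inj _ _] := colP.
have YZ v z : v \in Y -> z \in Z -> (r v < r z)%N.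
  case: conf => -[dX _ _] _ _ _ vY zZ.
  have /set0Pn[u uX] : X != set0.
    by rewrite -card_gt0 -(ltr0n R) (lt_le_trans d_gt0).
  by move: s2; rewrite -(types u v z).
have sub := link_pairs b dYZ.
have mem v z : (r v < r z)%N && ([set v; z] \in link Y Z b)
    = [&& v \in Y, z \in Z & col v z == b].
  rewrite mem_link //; apply/idP/idP => [|/and3P[vY zZ ->]]; last first.
    by rewrite YZ // vY zZ.
  move=> /and3P[vz -> /orP[/andP[-> ->]//|/andP[vZ zY]]].
  by have := YZ _ _ zY vZ; lia.
have H1 := count_close (fun _ b' _ => b' == b).
have H2 := count_close (fun a b' c => (b' == b) && allowed s a b c).
have w1 : \sum_(a : Phi) \sum_b' \sum_(c : Phi | b' == b) x a * x b' * x c = x b.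
  under eq_bigr => a _.
    rewrite (bigD1 b) //= [X in _ + X]big1 ?addr0 => [|b' /negPf b'b]; last first.
      by rewrite big_pred0 // => c; rewrite b'b.
    rewrite (eq_bigl xpredT) => [|c]; last by rewrite eqxx.
    rewrite -mulr_sumr x_sum mulr1 mulrC.
    over.
  by rewrite -mulr_sumr x_sum mulr1.
have w2 : \sum_(a : Phi) \sum_b' \sum_(c : Phi | (b' == b) && allowed s a b c)
    x a * x b' * x c = x b * colour_sum x s b.
  rewrite mulr_sumr; apply: eq_bigr => a _.
  rewrite (bigD1 b) //= [X in _ + X]big1 ?addr0 => [|b' /negPf b'b]; last first.
    by rewrite big_pred0 // => c; rewrite b'b.
  rewrite eqxx mulr_sumr; apply: eq_bigr => c _; ring.
rewrite w1 in H1; rewrite w2 in H2; apply: (density_transfer H1 H2).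
have := dense X _ sub; rewrite (e_evE _ r_inj) // (card_pairset _ r_inj) //.
have -> : \sum_y \sum_z ((r y < r z)%N && ([set y; z] \in link Y Z b))%:R
    = \sum_(y in Y) \sum_(z in Z) (col y z == b)%:R :> R.
  by rewrite sum_in2; do 2![apply: eq_bigr => ? _]; rewrite mem.
rewrite sumr_const -[(\sum_(y in Y) _) *+ _]mulr_natl (mulrA D).
move=> /le_trans; apply.
apply: ler_sum => u uX; rewrite sum_in2.
apply: ler_sum => y _; apply: ler_sum => z _; rewrite ler_nat andbA mem.
case: (boolP (y \in Y)) => //= yY; case: (boolP (z \in Z)) => //= zZ.
case: eqP => //= yzb; case E: (_ \in edges H) => //.
by have := edge_allowed colP E; rewrite types // yzb => ->.
Qed.

Lemma upper_ee a b : uniformly_dense ee D eta H ->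
  D * (x a * x b) <= x a * x b * pair_sum x s a b + 3 * k.
Proof.
move=> dense; have [_ _ [dXY dYZ dXZ] types] := conf.
have mem u v z : ([set u; v] \in link X Y a) && ([set v; z] \in link Y Z b)
    = [&& u \in X, v \in Y, z \in Z, col u v == a & col v z == b].
  rewrite !mem_link //; apply/idP/idP; last first.
    by case/and5P=> -> -> -> -> ->.
  (* The middle vertex belongs to a pair of each link, so disjointness of the parts forces it into
     [Y], and then [u] into [X] and [z] into [Z]. *)
  case/andP=> /andP[-> h1] /andP[-> h2]; rewrite !andbT.
  case/orP: h1 => /andP[h1 h2']; case/orP: h2 => /andP[h3 h4].
  - by rewrite h1 h2' h4.
  - by rewrite (disjointFl dYZ) in h2'.
  - by rewrite (disjointFr dXY) in h3.
  - by rewrite (disjointFr dXZ) in h3.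
pose w0 a' b' (c : Phi) := (a' == a) && (b' == b).
have H1 := count_close w0.
have H2 := count_close (fun a' b' c => w0 a' b' c && allowed s a' b' c).
have pick (w : Phi -> bool) : \sum_a' \sum_b' \sum_(c | w0 a' b' c && w c)
    x a' * x b' * x c = x a * x b * \sum_(c | w c) x c.
  rewrite (bigD1 a) //= [X in _ + X]big1 ?addr0 => [|a' /negPf a'a]; last first.
    by apply: big1 => b' _; rewrite big_pred0 // => c; rewrite /w0 a'a.
  rewrite (bigD1 b) //= [X in _ + X]big1 ?addr0 => [|b' /negPf b'b]; last first.
    by rewrite big_pred0 // => c; rewrite /w0 b'b andbF.
  by rewrite mulr_sumr; apply: eq_bigl => c; rewrite /w0 !eqxx.
have w1 : \sum_a' \sum_b' \sum_(c | w0 a' b' c) x a' * x b' * x c = x a * x b.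
  rewrite -[RHS]mulr1 -x_sum -pick; do 2![apply: eq_bigr => ? _].
  by apply: eq_bigl => c; rewrite andbT.
have w2 : \sum_a' \sum_b' \sum_(c | w0 a' b' c && allowed s a' b' c)
    x a' * x b' * x c = x a * x b * pair_sum x s a b.
  rewrite -pick; apply: eq_bigr => a' _; apply: eq_bigr => b' _.
  apply: eq_bigl => c; rewrite /w0.
  by case: eqP => //= ->; case: eqP => //= ->.
rewrite w1 in H1; rewrite w2 in H2; apply: (density_transfer H1 H2).
have := dense _ _ (link_pairs a dXY) (link_pairs b dYZ); rewrite K_eeE e_eeE.
have sum3 (F : V -> V -> V -> bool) :
    \sum_(u in X) \sum_(v in Y) \sum_(z in Z) (F u v z)%:R
    = \sum_u \sum_v \sum_z [&& u \in X, v \in Y, z \in Z & F u v z]%:R :> R.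
  rewrite sum_in; apply: eq_bigr => u _; rewrite sum_in2 mulr_sumr.
  apply: eq_bigr => v _; rewrite mulr_sumr; apply: eq_bigr => z _.
  by rewrite -natrM mulnb.
have -> : \sum_u \sum_v \sum_z
    (([set u; v] \in link X Y a) && ([set v; z] \in link Y Z b))%:R
  = \sum_(u in X) \sum_(v in Y) \sum_(z in Z) (w0 (col u v) (col v z) (col u z))%:R
    :> R.
  by rewrite sum3; do 3![apply: eq_bigr => ? _]; rewrite mem.
move=> /le_trans; apply; rewrite sum3.
apply: ler_sum => u _; apply: ler_sum => v _; apply: ler_sum => z _.
rewrite ler_nat andbA mem /w0.
case: (boolP (u \in X)) => //= uX; case: (boolP (v \in Y)) => //= vY.
case: (boolP (z \in Z)) => //= zZ; case: (col u v == a) => //=.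
case: (col v z == b) => //=; case E: (_ \in edges H) => //.
by have := edge_allowed colP E; rewrite types // => ->.
Qed.

End UpperBound.

(** * Compactness of the simplex and passage to the limit *)

Section Compactness.
Variables (R : realType) (P : palette).
Local Notation Phi := (colours P).
Local Notation T := (prod_topology (fun _ : Phi => R)).
Local Open Scope classical_set_scope.

Lemma simplex_compact : compact (@simplex R P : set T).
Proof.
rewrite (_ : @simplex R P = [set f : T | forall i, (`[0, 1]%classic : set R) (f i)]
    `&` [set x : T | \sum_a x a = 1]).
  apply: compact_closedI.
    by apply: (@tychonoff Phi (fun=> R) (fun=> `[0, 1]%classic)) => i;
      exact: segment_compact.
  by apply: cleq; apply: csum => i _; exact: ccoord.
by apply/seteqP; split => x /= [H1 H2]; split=> // a;
  have := H1 a; rewrite /= in_itv.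
Qed.

Lemma simplex_limit (I : finType) (h : I -> T -> R) :
  (forall i, continuous (h i)) ->
  (forall t, 0 < t -> exists2 x, @simplex R P x & forall i, h i x <= t) ->
  exists2 x, @simplex R P x & forall i, h i x <= 0.
Proof.
move=> h_cont approx.
(* The negated largest violation, never positive. It attains its maximum on the simplex by
   [usc_max]; a negative maximum is refuted by [approx] at half its absolute value. *)
pose f x := - \big[Num.max/0]_i h i x.
pose g t := [set x : T | 0 <= - t /\ forall i, h i x <= - t].
have fP t x : t <= f x <-> g t x.
  rewrite /f /g lerNr /=; split=> [/bigmax_leP[t0 ht]|[t0 ht]].
    by split=> // i; exact: ht.
  by apply/bigmax_leP; split=> // i _; exact: ht.
have g_closed t : topology_structure.closed (g t).
  have [t0|t0] := boolP (0 <= - t); last first.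
    rewrite (_ : g t = classical_sets.set0); first exact: closed0.
    by apply/seteqP; split=> // x [h0]; rewrite h0 in t0.
  rewrite (_ : g t = \bigcap_(i in [set: I]) [set x | h i x <= - t]).
    by apply: closed_bigI => i _; exact: clle.
  by apply/seteqP; split=> [x [_ hx] i _|x hx]; [|split=> // i]; exact: hx.
have simplex_neq0 : (@simplex R P : set T) !=set0.
  by have [x Sx _] := approx 1 ltr01; exists x.
have [x0 Sx0 x0_max] :=
  usc_max simplex_compact simplex_neq0 g_closed (fun t x _ => fP t x).
exists x0 => // i.
have f0 : 0 <= f x0.
  rewrite leNgt; apply/negP => f_lt0.
  have [|y Sy hy] := approx (- f x0 / 2); first by rewrite divr_gt0 // oppr_gt0.
  have : f x0 / 2 <= f y.
    by apply/fP; split=> [|j]; [rewrite oppr_ge0; lra|rewrite -mulNr; exact: hy].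
  by have := x0_max y Sy; lra.
by have [_ /(_ i)] := (fP 0 x0).1 f0; rewrite oppr0.
Qed.

End Compactness.

(** * Bounds for the Lagrangian *)

Section LagrangianBounds.
Variables (R : realType) (P : palette).
Local Notation Phi := (colours P).
Implicit Types (x : Phi -> R).
Local Open Scope classical_set_scope.

Lemma simplex_pos x : simplex x -> exists a, 0 < x a.
Proof.
move=> [x01 x_sum]; apply: contrapT => /forallNP x0.
have : \sum_a x a = 0.
  apply: big1 => a _; apply/eqP; rewrite eq_le; have /andP[-> _] := x01 a.
  by rewrite andbT leNgt; apply/negP; exact: x0.
by rewrite x_sum => /eqP; rewrite oner_eq0.
Qed.

Lemma le_lambda_ev x t : simplex x ->
  (forall b, 0 < x b -> t <= lambda_colour x b) -> t <= lambda_ev x.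
Proof.
move=> Sx H; apply: lb_le_inf; last by move=> _ [b xb <-]; exact: H.
by have [b xb] := simplex_pos Sx; exists (lambda_colour x b), b.
Qed.

Lemma le_lambda_ee x t : simplex x ->
  (forall a b, 0 < x a -> 0 < x b -> t <= lambda_pair x a b) ->
  t <= lambda_ee x.
Proof.
move=> Sx H; have x_ge0 a : 0 <= x a by case: Sx => /(_ a)/andP[].
apply: lb_le_inf => [|_ [[a b] /= xab <-]].
  have [b xb] := simplex_pos Sx; exists (lambda_pair x b b), (b, b) => //=.
  by rewrite mulr_gt0.
have xa : 0 < x a.
  by rewrite lt0r x_ge0 andbT; apply: contraTneq xab => ->; rewrite mul0r ltxx.
by apply: H => //; rewrite pmulr_rgt0 in xab.
Qed.

Lemma lambda_ev_le x b : (forall a, 0 <= x a) -> 0 < x b ->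
  lambda_ev x <= lambda_colour x b.
Proof.
move=> x_ge0 xb; apply: ge_inf; last by exists b.
by exists 0 => _ [c _ <-]; rewrite /lambda_colour !le_min; apply/and3P; split;
  do 2![apply: sumr_ge0 => ? _]; rewrite mulr_ge0.
Qed.

Lemma lambda_ee_le x a b : (forall c, 0 <= x c) -> 0 < x a -> 0 < x b ->
  lambda_ee x <= lambda_pair x a b.
Proof.
move=> x_ge0 xa xb; apply: ge_inf; last by exists (a, b) => //=; rewrite mulr_gt0.
exists 0 => _ [c _ <-]; rewrite /lambda_pair !le_min.
by rewrite !sumr_ge0.
Qed.

Lemma lambda_le_lagrangian star x : simplex x ->
  lambda star x <= lagrangian R P star.
Proof. by have [x0 [_ <- x0_max]] := lagrangian_max R P star; exact: x0_max. Qed.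

Lemma lagrangian01 star : 0 <= lagrangian R P star <= 1.
Proof.
have [x [Sx <- _]] := lagrangian_max R P star.
have [x01 x_sum] := Sx; have x_ge0 a : 0 <= x a by case/andP: (x01 a).
have le_sum (Q : pred Phi) : \sum_(a | Q a) x a <= 1.
  by rewrite -x_sum [leRHS](bigID Q) /= lerDl sumr_ge0.
have [a xa] := simplex_pos Sx.
have le2 (Q : Phi -> pred Phi) : \sum_c \sum_(d | Q c d) x c * x d <= 1.
  rewrite -x_sum; apply: ler_sum => c _.
  by rewrite -mulr_sumr ler_piMr.
case: star => /=; apply/andP; split.
- by do 3![apply: sumr_ge0 => ? _]; rewrite !mulr_ge0.
- rewrite -x_sum; apply: ler_sum => b _.
  under eq_bigr do under eq_bigr do rewrite -mulrA.
  under eq_bigr do rewrite -mulr_sumr.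
  by rewrite -mulr_sumr ler_piMr.
- apply: le_lambda_ev => // b _; rewrite /lambda_colour !le_min.
  by apply/and3P; split; do 2![apply: sumr_ge0 => ? _]; rewrite mulr_ge0.
- apply: le_trans (lambda_ev_le x_ge0 xa) _.
  by rewrite /lambda_colour ge_min le2.
- by apply: le_lambda_ee => // b c _ _; rewrite /lambda_pair !le_min !sumr_ge0.
- apply: le_trans (lambda_ee_le x_ge0 xa xa) _.
  by rewrite /lambda_pair ge_min le_sum.
Qed.

End LagrangianBounds.

Section TuranUpper.
Variables (R : realType) (P : palette) (star : density_kind) (D : R).
Local Notation Phi := (colours P).
Local Notation T := (prod_topology (fun _ : Phi => R)).
Local Open Scope classical_set_scope.
Hypothesis D01 : 0 <= D <= 1.
Hypothesis dense_graphs : forall (eta : R) (n : nat), 0 < eta ->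
  exists H : graph3, [/\ (n <= #|vertex H|)%N, colourable P H
    & uniformly_dense star D eta H].

(** A single [x] has to serve all order types, since [lambda_colour] and [lambda_pair] are minima
    over them. It is therefore fixed first, and its sets are permuted afterwards for each [s]. *)
Lemma upper_tolerance (t : R) : 0 < t -> exists2 x : Phi -> R, simplex x &
  forall s, transitive_type s ->
  match star return Prop with
  | vvv => D <= palette_sum x s + t
  | ev => s.1.2 -> forall b, D * x b <= x b * colour_sum x s b + t
  | ee => forall a b, D * (x a * x b) <= x a * x b * pair_sum x s a b + t
  end.
Proof.
move=> t_gt0; pose k := t / 3; have k_gt0 : 0 < k by rewrite divr_gt0.
pose q : R := #|{: Phi}|%:R + 1; have q_gt0 : 0 < q by rewrite ltr_wpDl.
pose e := k / q ^+ 3; have e_gt0 : 0 < e by rewrite divr_gt0 ?exprn_gt0.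
have e_small : #|{: Phi}|%:R ^+ 3 * e <= k.
  rewrite mulrCA ler_piMr ?(ltW k_gt0) // ler_pdivrMr ?exprn_gt0 // mul1r.
  by rewrite lerXn2r ?nnegrE ?(ltW q_gt0) // lerDl.
have [delta [N [delta_gt0 triple]]] := homogeneous_triple Phi e_gt0.
(* With this [eta] the error term equals [k] times the cube of the guaranteed size [delta * #|V|] of
   the parts; the successor makes the vertex set nonempty. *)
have [|H [le_n [r [col colP]] dense]] := @dense_graphs (k * delta ^+ 3) N.+1.
  by rewrite mulr_gt0 ?exprn_gt0.
have [r_inj col_sym _] := colP.
have [x [A [B [C [[x01 x_sum hom] sizes [AB BC]]]]]] :=
  triple _ _ col r_inj (ltnW le_n).
have d_gt0 : 0 < delta * #|vertex H|%:R.
  by rewrite mulr_gt0 // ltr0n (leq_ltn_trans _ le_n).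
have eta_small : k * delta ^+ 3 * #|vertex H|%:R ^+ 3
    <= k * (delta * #|vertex H|%:R) ^+ 3.
  by rewrite le_eqVlt; apply/orP; left; apply/eqP; ring.
have tE : t = 3 * k by rewrite /k; field.
exists x => // s tr.
have [X [Y [Z conf]]] := configuration_exists col_sym tr hom sizes d_gt0 AB BC.
have e0 := ltW e_gt0.
case: star dense => dense; rewrite tE.
- exact: (upper_vvv colP e0 d_gt0 conf D01 e_small eta_small dense).
- move=> s2 b.
  exact: (upper_ev colP x_sum e0 d_gt0 conf D01 e_small eta_small _ dense s2).
- move=> a b.
  exact: (upper_ee colP x_sum e0 d_gt0 conf D01 e_small eta_small _ _ dense).
Qed.

Lemma turan_upper : D <= lagrangian R P star.
Proof.
have cont_coord a := @ccoord R P a.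
have csub (f g : T -> R) : continuous f -> continuous g ->
    continuous (fun x => f x - g x).
  by move=> hf hg x; exact: (@cvgB R R^o T (nbhs x) _ f g (f x) (g x) (hf x) (hg x)).
move: upper_tolerance; case: star => approx.
- apply/ler_addgt0Pr => t /approx[x Sx /(_ (true, true, true) isT)].
  move=> /le_trans; apply; rewrite lerD2r palette_sumE //.
  exact: (lambda_le_lagrangian vvv Sx).
(* Still multiplied by [x b], the inequality is continuous in [x]; division by [x b] takes place
   only after the limit, for colours of positive weight. *)
- pose h (i : Phi * (bool * bool * bool)) (x : Phi -> R) :=
    if transitive_type i.2 && i.2.1.2 then
      D * x i.1 - x i.1 * colour_sum x i.2 i.1 else 0.
  have [||x Sx hx] := @simplex_limit R P (Phi * (bool * bool * bool))%type h.
  + move=> [b s]; rewrite /h /=.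
    case: (transitive_type s && _); last exact: cst_continuous.
    apply: csub; first by apply: cmul => //; exact: cst_continuous.
    apply: cmul => //; apply: csum => a _; apply: csum => c _.
    exact: cmul.
  + move=> t t0; have [x Sx Hx] := approx t t0; exists x => // -[b s]; rewrite /h /=.
    case: ifP => [/andP[tr s2]|_]; last exact: ltW.
    by have := Hx s tr s2 b; lra.
  apply: le_trans (lambda_le_lagrangian ev Sx).
  apply: le_lambda_ev => // b xb; apply: lambda_colour_ge => s tr s2.
  have := hx (b, s); rewrite /h /= tr s2 /= mulrC -mulrBr.
  by rewrite pmulr_rle0 // subr_le0.
- pose h (i : Phi * Phi * (bool * bool * bool)) (x : Phi -> R) :=
    if transitive_type i.2 then
      D * (x i.1.1 * x i.1.2)
      - x i.1.1 * x i.1.2 * pair_sum x i.2 i.1.1 i.1.2 else 0.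
  have [||x Sx hx] := @simplex_limit R P (Phi * Phi * (bool * bool * bool))%type h.
  + move=> [[a b] s]; rewrite /h /=.
    case: (transitive_type s); last exact: cst_continuous.
    apply: csub.
      by apply: cmul; [exact: cst_continuous|exact: cmul].
    apply: cmul; first exact: cmul.
    by apply: csum => c _.
  + move=> t t0; have [x Sx Hx] := approx t t0; exists x => // -[[a b] s].
    rewrite /h /=.
    case: ifP => [tr|_]; last exact: ltW.
    by have := Hx s tr a b; lra.
  apply: le_trans (lambda_le_lagrangian ee Sx).
  apply: le_lambda_ee => // a b xa xb; apply/le_lambda_pair => s tr.
  have := hx (a, b, s); rewrite /h /= tr mulrC -mulrBr.
  by rewrite pmulr_rle0 ?mulr_gt0 // subr_le0.
Qed.

End TuranUpper.

(** * Lower bound *)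

Section LowerBound.
Variables (R : realType) (P : palette) (V : finType) (r : V -> nat).
Local Notation Phi := (colours P).
Variables (col : V -> V -> Phi) (x : Phi -> R) (C : R).
Hypothesis r_inj : injective r.
Hypothesis col_sym : forall u v, col u v = col v u.
Hypothesis x01 : forall a, 0 <= x a <= 1.
Hypothesis x_sum : \sum_a x a = 1.
Hypothesis x_pos : forall u v, 0 < x (col u v).
Hypothesis C_ge0 : 0 <= C.
Hypothesis col_cut : forall c, cut_close [set: V] [set: V]
  (fun u v => (r u < r v)%N && (col u v == c)) (fun u v => (r u < r v)%N) (x c) C.

Implicit Types (X Y Z : {set V}) (f g : rel V) (s : bool * bool * bool).

Let q : R := #|{: Phi}|%:R.
Let n : R := #|V|%:R.

Lemma natr_andb (b b' : bool) : (b && b')%:R = b%:R * b'%:R :> R.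
Proof. by rewrite -natrM mulnb. Qed.

Lemma eq_cut_close X Y f f' g g' w D : f =2 f' -> g =2 g' ->
  cut_close X Y f g w D -> @cut_close R V X Y f' g' w D.
Proof.
move=> ff gg H S T SX TY; have := H S T SX TY.
by under eq_bigr do under eq_bigr do rewrite ff gg.
Qed.

(** The condition [u != v] matters for [b = false]: on the diagonal [r u < r v] fails as well. *)
Definition ordered (b : bool) : rel V :=
  fun u v => (u != v) && ((r u < r v)%N == b).

Definition slot (b : bool) (c : Phi) : rel V :=
  fun u v => ordered b u v && (col u v == c).

(** Increasing pairs are covered by [col_cut]; decreasing pairs follow by transposition, because
    [col] is symmetric. *)
Lemma slot_cut X Y b c :
  cut_close X Y (slot b c) (ordered b) (x c) C.
Proof.
suff H : cut_close [set: V] [set: V] (slot b c) (ordered b) (x c) C.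
  by move=> S T _ _; apply: H; exact: subsetT.
case: b.
  have ordT : ordered true =2 (fun u v => (r u < r v)%N).
    move=> u v; rewrite /ordered eqb_id; have [->|//] := eqVneq u v.
    by rewrite ltnn.
  apply: eq_cut_close (col_cut c) => u v; rewrite /slot ordT //.
have ordF : ordered false =2 (fun u v => (r v < r u)%N).
  move=> u v; rewrite /ordered eqbF_neg -leqNgt leq_eqVlt.
  by have [->|uv] := eqVneq u v; rewrite ?ltnn // (inj_eq r_inj) eq_sym (negPf uv).
apply: eq_cut_close (cut_close_tr (col_cut c)) => u v; rewrite /slot ordF //.
by rewrite col_sym.
Qed.

Definition distinct3 (u v z : V) := [&& u != v, v != z & u != z].

Lemma sum_slot (F : Phi -> R) b u v :
  \sum_a F a * (slot b a u v)%:R = F (col u v) * (ordered b u v)%:R.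
Proof.
rewrite (bigD1 (col u v)) //= big1 => [|a /negPf ne].
  by rewrite addr0 /slot eqxx andbT.
by rewrite /slot eq_sym ne andbF mulr0.
Qed.

Lemma tri_sum1 X Y Z f g h b :
  \sum_a tri R X Y Z (fun u v => f u v && slot b a u v) g h
    = tri R X Y Z (fun u v => f u v && ordered b u v) g h.
Proof.
rewrite /tri exchange_big; apply: eq_bigr => u _.
rewrite exchange_big; apply: eq_bigr => v _.
rewrite exchange_big; apply: eq_bigr => z _.
rewrite -!mulr_suml; congr (_ * _ * _).
under eq_bigr do rewrite natr_andb; rewrite natr_andb.
exact: (sum_slot (fun=> (f u v)%:R)).
Qed.

Lemma tri_sum2 X Y Z f g h b :
  \sum_a tri R X Y Z f (fun u v => g u v && slot b a u v) h
    = tri R X Y Z f (fun u v => g u v && ordered b u v) h.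
Proof.
under eq_bigr do rewrite tri_rot; rewrite [RHS]tri_rot; exact: tri_sum1.
Qed.

Local Notation E := (edges (palette_graph r col)).

Definition type_count f g X Y Z s : R :=
  tri R X Y Z (fun u v => f u v && ordered s.1.1 u v)
    (fun v z => g v z && ordered s.1.2 v z) (ordered s.2).

Definition type_edges f g X Y Z s : R :=
  \sum_a \sum_b \sum_(c | allowed s a b c)
    tri R X Y Z (fun u v => f u v && slot s.1.1 a u v)
      (fun v z => g v z && slot s.1.2 b v z) (slot s.2 c).

(** For fixed vertices only the actual colours of the three pairs survive in the sums over [a], [b]
    and [c]. *)
Lemma type_edgesE f g X Y Z s : type_edges f g X Y Z s =
  \sum_(u in X) \sum_(v in Y) \sum_(z in Z)
    (f u v && ordered s.1.1 u v)%:R * (g v z && ordered s.1.2 v z)%:R *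
    (ordered s.2 u z)%:R * (allowed s (col u v) (col v z) (col u z))%:R.
Proof.
transitivity (\sum_a \sum_b \sum_c \sum_(u in X) \sum_(v in Y) \sum_(z in Z)
  (f u v && slot s.1.1 a u v)%:R * ((g v z && slot s.1.2 b v z)%:R *
    ((allowed s a b c)%:R * (slot s.2 c u z)%:R)) : R).
  apply: eq_bigr => a _; apply: eq_bigr => b _; rewrite big_mkcond.
  apply: eq_bigr => c _; case: ifP => _; last first.
    by symmetry; do 3![apply: big1 => ? _]; rewrite mul0r !mulr0.
  by do 3![apply: eq_bigr => ? _]; rewrite mul1r mulrA.
under eq_bigr => a _.
  under eq_bigr => b _.
    rewrite exchange_big; under eq_bigr => u _.
      rewrite exchange_big; under eq_bigr => v _ do rewrite exchange_big.
      over.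
    over.
  rewrite exchange_big; under eq_bigr => u _.
    rewrite exchange_big; under eq_bigr => v _ do rewrite exchange_big.
    over.
  over.
rewrite exchange_big; apply: eq_bigr => u _ /=.
rewrite exchange_big; apply: eq_bigr => v _ /=.
rewrite exchange_big; apply: eq_bigr => z _ /=.
under eq_bigr => a _.
  under eq_bigr => b _.
    rewrite -!mulr_sumr (sum_slot (fun c => (allowed s a b c)%:R)).
    rewrite (natr_andb (g v z) (slot _ _ _ _)).
    over.
  over.
under eq_bigr => a _.
  rewrite -mulr_sumr.
  rewrite (_ : \sum_b _ = (g v z && ordered s.1.2 v z)%:R *
    ((allowed s a (col v z) (col u z))%:R * (ordered s.2 u z)%:R)); last first.
    transitivity (\sum_b ((g v z)%:R * ((allowed s a b (col u z))%:R *
        (ordered s.2 u z)%:R)) * (slot s.1.2 b v z)%:R : R).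
      by apply: eq_bigr => b _; ring.
    by rewrite sum_slot natr_andb; ring.
  rewrite (natr_andb (f u v) (slot _ _ _ _)).
  over.
transitivity (\sum_a ((f u v)%:R * ((g v z && ordered s.1.2 v z)%:R *
    ((allowed s a (col v z) (col u z))%:R * (ordered s.2 u z)%:R))) *
    (slot s.1.1 a u v)%:R : R).
  by apply: eq_bigr => a _; ring.
by rewrite sum_slot (natr_andb (f u v)); ring.
Qed.

Lemma sum_ordered (F : bool -> R) u v :
  \sum_b F b * (ordered b u v)%:R = F (r u < r v)%N * (u != v)%:R.
Proof.
rewrite (bigD1 (r u < r v)%N) //= big1 => [|b /negPf ne].
  by rewrite addr0 /ordered eqxx andbT.
by rewrite /ordered [_ == b]eq_sym ne andbF mulr0.
Qed.

Lemma sum_types (F : bool * bool * bool -> R) u v z :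
  \sum_s F s * ((ordered s.1.1 u v)%:R * (ordered s.1.2 v z)%:R
      * (ordered s.2 u z)%:R)
    = F (order_type r u v z) * (distinct3 u v z)%:R.
Proof.
transitivity (\sum_b1 \sum_b2 \sum_b3 F (b1, b2, b3) * ((ordered b1 u v)%:R *
   (ordered b2 v z)%:R * (ordered b3 u z)%:R)).
  by rewrite !pair_bigA; apply: eq_bigr => -[[]].
transitivity (\sum_b1 (F (b1, r v < r z, r u < r z)%N * (v != z)%:R
    * (u != z)%:R) * (ordered b1 u v)%:R).
  apply: eq_bigr => b1 _.
  transitivity (\sum_b2 (F (b1, b2, r u < r z)%N * (u != z)%:R *
     (ordered b1 u v)%:R) * (ordered b2 v z)%:R).
    apply: eq_bigr => b2 _.
    transitivity (\sum_b3 (F (b1, b2, b3) * (ordered b1 u v)%:R *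
      (ordered b2 v z)%:R) * (ordered b3 u z)%:R).
      by apply: eq_bigr => b3 _; ring.
    by rewrite (sum_ordered (fun b3 => F (b1, b2, b3) * _ * _)); ring.
  by rewrite (sum_ordered (fun b2 => F (b1, b2, _) * _ * _)); ring.
rewrite (sum_ordered (fun b1 => F (b1, _, _) * _ * _)) /order_type /distinct3.
by rewrite !natr_andb; ring.
Qed.

(** Triples of distinct vertices are split by the three comparisons into eight patterns, each
    treated as a product of relations; hence the factor 8. An allowed triple of distinct vertices is
    an edge by [allowed_edge]. *)
Lemma lower_core f g X Y Z (L err : R) :
  (forall s, L * type_count f g X Y Z s - err <= type_edges f g X Y Z s) ->
  L * (\sum_(u in X) \sum_(v in Y) \sum_(z in Z)
      [&& f u v, g v z & distinct3 u v z]%:R) - 8 * err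
  <= \sum_(u in X) \sum_(v in Y) \sum_(z in Z)
      [&& f u v, g v z & [set u; v; z] \in E]%:R.
Proof.
move=> H.
have swap3 (F : bool * bool * bool -> V -> V -> V -> R) :
    \sum_s \sum_(u in X) \sum_(v in Y) \sum_(z in Z) F s u v z
    = \sum_(u in X) \sum_(v in Y) \sum_(z in Z) \sum_s F s u v z.
  rewrite exchange_big; apply: eq_bigr => u _; rewrite exchange_big.
  by apply: eq_bigr => v _; rewrite exchange_big.
apply: (@le_trans _ _ (\sum_s type_edges f g X Y Z s)).
  apply: (@le_trans _ _ (\sum_s (L * type_count f g X Y Z s - err))).
    rewrite sumrB -mulr_sumr sumr_const.
    have -> : #|{: bool * bool * bool}| = 8%N by rewrite !card_prod card_bool.
    rewrite -[err *+ 8]mulr_natl /type_count /tri swap3 le_eqVlt.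
    apply/orP; left; apply/eqP; congr (L * _ - _).
    apply: eq_bigr => u _; apply: eq_bigr => v _; apply: eq_bigr => z _.
    transitivity (\sum_s (f u v)%:R * (g v z)%:R * ((ordered s.1.1 u v)%:R *
        (ordered s.1.2 v z)%:R * (ordered s.2 u z)%:R) : R).
      rewrite (sum_types (fun=> (f u v)%:R * (g v z)%:R)).
      by rewrite !natr_andb; ring.
    by apply: eq_bigr => s _; rewrite !natr_andb; ring.
  by apply: ler_sum => s _; exact: H.
under eq_bigr do rewrite type_edgesE; rewrite swap3.
apply: ler_sum => u _; apply: ler_sum => v _; apply: ler_sum => z _.
rewrite (eq_bigr (fun s => (f u v)%:R * (g v z)%:R *
    (allowed s (col u v) (col v z) (col u z))%:R * ((ordered s.1.1 u v)%:R *
        (ordered s.1.2 v z)%:R * (ordered s.2 u z)%:R))); last first.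
  by move=> s _; rewrite !natr_andb; ring.
rewrite (sum_types (fun s => _ * (allowed s _ _ _)%:R)) -!natr_andb ler_nat.
case: (f u v) (g v z) => [] [] //=; case E: (_ && _) => //.
have /andP[ok dist] := E.
by rewrite (allowed_edge r_inj col_sym dist ok).
Qed.

Lemma tri_ge0 X Y Z f g h : 0 <= tri R X Y Z f g h.
Proof. by do 3![apply: sumr_ge0 => ? _]; rewrite !mulr_ge0. Qed.

Lemma sum_tolerance (Q : pred Phi) (F G : Phi -> R) (t : R) : 0 <= t ->
  (forall c, G c - t <= F c) -> \sum_(c | Q c) G c - q * t <= \sum_(c | Q c) F c.
Proof.
move=> t0 GF; rewrite lerBlDr -lerBlDl -sumrB [leLHS]big_mkcond.
apply: sum_le_card => // c; case: (Q c) => //.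
by have := GF c; lra.
Qed.

Lemma slot_absent b a u v : ~~ (0 < x a) -> slot b a u v = false.
Proof.
move=> xa; apply/negP => /andP[_ /eqP e]; move: xa; rewrite -e.
by rewrite x_pos.
Qed.

Let nC := n * C.

Lemma card_nC X : #|X|%:R * C <= nC.
Proof. by rewrite ler_wpM2r // ler_nat max_card. Qed.

Lemma nC_ge0 : 0 <= nC.
Proof. by rewrite mulr_ge0. Qed.

(** The colours [a] and [b] are fixed on the prescribed pairs, and only the pair [(u, z)] is
    replaced by its expectation. If [x a] or [x b] is not positive, no pair has that colour and the
    count [T] is zero. The allowance [3 * nC] is common to the three kinds of density. *)
Lemma type_edges_ee f g X Y Z (L : R) s :
  (forall a b, 0 < x a -> 0 < x b -> L <= pair_sum x s a b) ->
  L * type_count f g X Y Z s - q * (q * (q * (3 * nC)))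
    <= type_edges f g X Y Z s.
Proof.
move=> HL; have nC0 := nC_ge0; have q0 : 0 <= q by [].
rewrite /type_count -tri_sum1 mulr_sumr.
apply: sum_tolerance => [|a]; first by rewrite !mulr_ge0.
rewrite -tri_sum2 mulr_sumr.
apply: sum_tolerance => [|b]; first by rewrite !mulr_ge0.
set T := tri _ _ _ _ _ _ _.
apply: (@le_trans _ _ (\sum_(c | allowed s a b c) x c * T - q * (3 * nC))).
  rewrite lerD2r -mulr_suml -/(pair_sum x s a b).
  have [/andP[xa xb]|xab] := boolP ((0 < x a) && (0 < x b)).
    by rewrite ler_wpM2r ?tri_ge0 ?HL.
  rewrite (_ : T = 0) ?mulr0 // /T /tri; do 3![apply: big1 => ? _].
  move: xab; rewrite negb_and => /orP[] nx; rewrite (slot_absent _ _ _ nx) andbF /=.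
    by rewrite !mul0r.
  by rewrite mulr0 mul0r.
apply: sum_tolerance => [|c]; first by rewrite mulr_ge0.
have := tri_swap3 Y (fun u v => f u v && slot s.1.1 a u v)
  (fun v z => g v z && slot s.1.2 b v z) (@slot_cut X Z s.2 c).
rewrite ler_norml => /andP[h _]; have := card_nC Y; rewrite -/T in h; lra.
Qed.

Lemma type_edges_ev g X Y Z (L : R) s :
  (forall b, 0 < x b -> L <= colour_sum x s b) ->
  L * type_count (fun _ _ => true) g X Y Z s - q * (q * (q * (3 * nC)))
    <= type_edges (fun _ _ => true) g X Y Z s.
Proof.
move=> HL; have nC0 := nC_ge0; have q0 : 0 <= q by [].
rewrite /type_count /type_edges exchange_big -tri_sum2 mulr_sumr.
apply: sum_tolerance => [|b]; first by rewrite !mulr_ge0.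
set T := tri _ _ _ _ _ _ _.
apply: (@le_trans _ _ (\sum_a \sum_(c | allowed s a b c) x a * x c * T
    - q * (q * (3 * nC)))).
  rewrite lerD2r; under [leRHS]eq_bigr do rewrite -mulr_suml.
  rewrite -mulr_suml -/(colour_sum x s b).
  have [xb|xb] := boolP (0 < x b); first by rewrite ler_wpM2r ?tri_ge0 ?HL.
  rewrite (_ : T = 0) ?mulr0 // /T /tri; do 3![apply: big1 => ? _].
  by rewrite (slot_absent _ _ _ xb) andbF /= mulr0 mul0r.
apply: sum_tolerance => [|a]; first by rewrite !mulr_ge0.
apply: sum_tolerance => [|c]; first by rewrite mulr_ge0.
have := tri_count2 (fun v z => g v z && slot s.1.2 b v z) (x01 a)
  (@slot_cut X Y s.1.1 a) (@slot_cut X Z s.2 c).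
rewrite ler_norml mulrA => /andP[h _]; have := card_nC Y; have := card_nC Z.
rewrite -/T in h; lra.
Qed.

Lemma type_edges_vvv X Y Z (L : R) s : L <= palette_sum x s ->
  L * type_count (fun _ _ => true) (fun _ _ => true) X Y Z s
      - q * (q * (q * (3 * nC)))
    <= type_edges (fun _ _ => true) (fun _ _ => true) X Y Z s.
Proof.
move=> HL; have nC0 := nC_ge0; have q0 : 0 <= q by [].
rewrite /type_count; set T := tri _ _ _ _ _ _ _.
apply: (@le_trans _ _ (\sum_a \sum_b \sum_(c | allowed s a b c)
    x a * x b * x c * T - q * (q * (q * (3 * nC))))).
  rewrite lerD2r; under [leRHS]eq_bigr do under eq_bigr do rewrite -mulr_suml.
  under [leRHS]eq_bigr do rewrite -mulr_suml.
  by rewrite -mulr_suml ler_wpM2r ?tri_ge0.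
apply: sum_tolerance => [|a]; first by rewrite !mulr_ge0.
apply: sum_tolerance => [|b]; first by rewrite !mulr_ge0.
apply: sum_tolerance => [|c]; first by rewrite mulr_ge0.
have := tri_count3 (x01 a) (x01 c) (@slot_cut X Y s.1.1 a) (@slot_cut X Z s.2 c)
  (@slot_cut Y Z s.1.2 b).
rewrite ler_norml => /andP[h _]; have := card_nC X; have := card_nC Y.
have := card_nC Z; rewrite -/T in h.
have -> : x a * x b * x c * T = x a * (x c * (x b * T)) by ring.
lra.
Qed.

(** Triples with a coincidence number at most [3 * n ^ 2], which is of lower order than the error
    permitted by the density condition. *)
Lemma distinct_loss f g X Y Z :
  \sum_(u in X) \sum_(v in Y) \sum_(z in Z) (f u v && g v z)%:R - 3 * n ^+ 2
  <= \sum_(u in X) \sum_(v in Y) \sum_(z in Z)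
      [&& f u v, g v z & distinct3 u v z]%:R.
Proof.
rewrite lerBlDr -lerBlDl -sumrB.
have pick (v : V) : \sum_z (v == z)%:R = 1 :> R.
  by rewrite (bigD1 v) //= eqxx big1 ?addr0 // => z /negPf; rewrite eq_sym => ->.
have nE (w : R) : w *+ #|V| = n * w by rewrite mulr_natl.
apply: (@le_trans _ _ (\sum_(u : V) \sum_(v : V) \sum_(z : V)
    ((u == v)%:R + (v == z)%:R + (u == z)%:R))); last first.
  rewrite le_eqVlt; apply/orP; left; apply/eqP.
  under eq_bigr => u _.
    under eq_bigr => v _.
      rewrite !big_split /= !pick sumr_const nE.
      over.
    rewrite !big_split /= -mulr_sumr pick !sumr_const !nE.
    over.
  by rewrite sumr_const nE; ring.
have restrict (A : {set V}) (F G : V -> R) : (forall u, 0 <= G u) ->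
    (forall u, F u <= G u) -> \sum_(u in A) F u <= \sum_u G u.
  move=> G0 FG; rewrite big_mkcond; apply: ler_sum => u _.
  by case: ifP.
apply: (restrict X) => u.
  by do 2![apply: sumr_ge0 => ? _]; rewrite !addr_ge0.
rewrite -sumrB; apply: (restrict Y) => v.
  by apply: sumr_ge0 => ? _; rewrite !addr_ge0.
rewrite -sumrB; apply: (restrict Z) => z; first by rewrite !addr_ge0.
rewrite /distinct3; case: (f u v); case: (g v z); case: eqP; case: eqP; case: eqP;
  by move=> *; rewrite /=; lra.
Qed.

End LowerBound.

(** * The two intransitive order patterns *)

Section IntransitiveTypes.
Variables (R : realType) (P : palette) (x : colours P -> R).
Hypothesis x_sum : \sum_a x a = 1.
Variable s : bool * bool * bool.
Hypothesis intransitive : ~~ transitive_type s.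

Lemma allowed_intransitive (a b c : colours P) : allowed s a b c.
Proof. by move: intransitive; case: s => [[[] []] []]. Qed.

(** All colours are allowed for an intransitive pattern, so the hypotheses that [lower_core] needs
    for all eight patterns reduce there to the Lagrangian being at most 1. *)
Lemma pair_sum1 a b : pair_sum x s a b = 1.
Proof.
by rewrite -x_sum; apply: eq_bigl => c; rewrite allowed_intransitive.
Qed.

Lemma colour_sum1 b : colour_sum x s b = 1.
Proof.
rewrite -x_sum; apply: eq_bigr => a _; rewrite -[RHS]mulr1 -(pair_sum1 a b).
by rewrite mulr_sumr.
Qed.

Lemma palette_sum1 : palette_sum x s = 1.
Proof.
rewrite -x_sum; apply: eq_bigr => a _; rewrite -[RHS]mulr1 -x_sum mulr_sumr.
apply: eq_bigr => b _; rewrite -[RHS]mulr1 -(pair_sum1 a b).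
by rewrite mulr_sumr.
Qed.

End IntransitiveTypes.

Lemma sum_setT (R : pzSemiRingType) (T : finType) (F : T -> R) :
  \sum_(u in [set: T]) F u = \sum_u F u.
Proof. by apply: eq_bigl => u; rewrite in_setT. Qed.

Lemma dense_palette_graph (R : realType) (P : palette) star (eta : R) (n0 : nat) :
  0 < eta -> exists H : graph3, [/\ (n0 <= #|vertex H|)%N, colourable P H
    & uniformly_dense star (lagrangian R P star) eta H].
Proof.
move=> eta_gt0; have [x [Sx lamE _]] := lagrangian_max R P star.
have [x01 x_sum] := Sx; have x_ge0 a : 0 <= x a by case/andP: (x01 a).
pose q : R := #|{: colours P}|%:R.
have q0 : 0 <= q by [].
(* The eight error terms sum to [24 * q ^ 3 * e * n ^ 3], at most half of [eta * n ^ 3]. The term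
   [6 / eta] in [N0] makes the loss from coincidences at most the other half. *)
pose e := eta / (48 * (q + 1) ^+ 3).
have q1_gt0 : 0 < q + 1 by rewrite ltr_wpDl.
have e_gt0 : 0 < e by rewrite divr_gt0 // mulr_gt0 // exprn_gt0.
pose N0 := (n0 + (Num.truncn (6 / eta)).+1)%N.
have [N [phi [le_N phi_pos cut]]] := random_colouring x_ge0 x_sum N0 e_gt0.
pose r := @nat_of_ord N; have r_inj : injective r by exact: ord_inj.
(* The random colouring lives on ordered pairs; reading it at the increasing enumeration makes it
   symmetric. *)
pose col u v := if (r u < r v)%N then phi u v else phi v u.
have col_sym u v : col u v = col v u.
  by rewrite /col; case: ltngtP => // /r_inj ->.
have x_pos u v : 0 < x (col u v) by rewrite /col; case: ifP.
pose C := e * N%:R ^+ 2.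
have C_ge0 : 0 <= C by rewrite mulr_ge0 ?exprn_ge0 // ltW.
have col_cut c : cut_close [set: 'I_N] [set: 'I_N]
    (fun u v => (r u < r v)%N && (col u v == c)) (fun u v => (r u < r v)%N) (x c) C.
  apply: eq_cut_close (cut c) => u v //.
  by rewrite /col /r; case: (u < v)%N.
exists (palette_graph r col); split.
- by rewrite card_ord (leq_trans _ le_N) // leq_addr.
- by exists r, col; exact: palette_graph_coloured.
set L := lagrangian R P star; have /andP[L0 L1] : 0 <= L <= 1 by exact: lagrangian01.
pose n : R := #|'I_N|%:R; have nE : n = N%:R by rewrite /n card_ord.
pose err := q * (q * (q * (3 * (n * C)))).
have n_large : 6 / eta <= n.
  rewrite nE ltW // (lt_le_trans (truncnS_gt _)) // ler_nat.
  by rewrite (leq_trans _ le_N) // leq_addl.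
have n_ge0 : 0 <= n by [].
have small : 8 * err + 3 * n ^+ 2 <= eta * n ^+ 3.
  have h1 : 3 * n ^+ 2 <= eta / 2 * n ^+ 3.
    have -> : eta / 2 * n ^+ 3 = (n * eta) / 2 * n ^+ 2 by ring.
    rewrite ler_wpM2r ?sqr_ge0 //.
    by move: n_large; rewrite ler_pdivrMr // => ?; lra.
  have h2 : 8 * err <= eta / 2 * n ^+ 3.
    have -> : 8 * err = q ^+ 3 * (24 * e) * n ^+ 3.
      by rewrite /err /C nE; ring.
    rewrite ler_wpM2r ?exprn_ge0 //.
    have -> : eta / 2 = (q + 1) ^+ 3 * (24 * e).
      by rewrite /e; field; rewrite gt_eqF.
    rewrite ler_wpM2r ?lerXn2r ?nnegrE ?(ltW q1_gt0) ?lerDl //.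
    by rewrite mulr_ge0 // ltW.
  by lra.
have finish (F D S : R) : F - 3 * n ^+ 2 <= D -> L * D - 8 * err <= S ->
    L * F - eta * n ^+ 3 <= S.
  move=> FD LDS; have := ler_wpM2l L0 FD; rewrite mulrBr.
  have : L * (3 * n ^+ 2) <= 3 * n ^+ 2 by rewrite ler_piMl ?mulr_ge0 ?exprn_ge0.
  by lra.
have loss := @distinct_loss R 'I_N.
have types s (F : bool * bool * bool -> R) : (transitive_type s -> L <= F s) ->
    (~~ transitive_type s -> F s = 1) -> L <= F s.
  by move=> h1 h2; have [/h1//|/h2->] := boolP (transitive_type s).
rewrite -/L in lamE; clearbody L.
have cardE : #|vertex (palette_graph r col)|%:R = n by [].
case: star lamE => /= lamE; rewrite -/n.
- move=> X Y Z.
  have HL s : L <= palette_sum x s.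
    apply: types => [tr|]; last exact: palette_sum1.
    by rewrite palette_sumE // -lamE.
  have core := lower_core r_inj col_sym (fun s => type_edges_vvv r_inj col_sym x01
    C_ge0 col_cut X Y Z (HL s)).
  rewrite e_vvvE; have := finish _ _ _ (loss _ _ X Y Z) core.
  have -> : L * #|X|%:R * #|Y|%:R * #|Z|%:R
      = L * (#|X|%:R * #|Y|%:R * #|Z|%:R) by ring.
  suff -> : \sum_(u in X) \sum_(v in Y) \sum_(z in Z) (true && true)%:R
      = #|X|%:R * #|Y|%:R * #|Z|%:R :> R by [].
  by rewrite -triT; do 3![apply: eq_bigr => ? _]; rewrite /= !mulr1.
- move=> X Q sub.
  pose g (u v : 'I_N) := (r u < r v)%N && ([set u; v] \in Q).
  have HL s b : 0 < x b -> L <= colour_sum x s b.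
    move=> xb; apply: (types s (fun s => colour_sum x s b)) => [tr|ntr]; last exact: colour_sum1.
    rewrite -lamE (le_trans (lambda_ev_le x_ge0 xb)) //.
    exact: lambda_colour_le.
  have core := lower_core r_inj col_sym (fun s => type_edges_ev r_inj col_sym x01
    x_pos C_ge0 col_cut g X setT setT (HL s)).
  have := finish _ _ _ (loss _ _ X setT setT) core.
  rewrite (@e_evE R (palette_graph r col) r r_inj) // -mulrA.
  rewrite (@card_pairset R (palette_graph r col) r r_inj) //.
  have -> : \sum_(u in X) \sum_(v in setT) \sum_(z in setT) (true && g v z)%:R
      = #|X|%:R * \sum_v \sum_z (g v z)%:R :> R.
    rewrite sumr_const [RHS]mulr_natl sum_setT; congr (_ *+ _).
    by apply: eq_bigr => v _; rewrite sum_setT.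
  move=> /le_trans; apply; apply: ler_sum => u _; rewrite sum_setT.
  apply: ler_sum => v _; rewrite sum_setT; apply: ler_sum => z _.
  by rewrite /g /= andbA.
- move=> Q Q' subQ subQ'.
  pose f (u v : 'I_N) := [set u; v] \in Q.
  pose g (u v : 'I_N) := [set u; v] \in Q'.
  have HL s a b : 0 < x a -> 0 < x b -> L <= pair_sum x s a b.
    move=> xa xb; apply: (types s (fun s => pair_sum x s a b)) => [tr|ntr]; last exact: pair_sum1.
    rewrite -lamE (le_trans (lambda_ee_le x_ge0 xa xb)) //.
    by have /le_lambda_pair/(_ s tr) := lexx (lambda_pair x a b).
  have core := lower_core r_inj col_sym (fun s => type_edges_ee r_inj col_sym
    x_pos C_ge0 col_cut f g setT setT setT (HL s)).
  have := finish _ _ _ (loss _ _ setT setT setT) core.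
  rewrite (@e_eeE R (palette_graph r col)) (@K_eeE R (palette_graph r col) Q Q').
  have expand (F : 'I_N -> 'I_N -> 'I_N -> R) :
      \sum_(u in setT) \sum_(v in setT) \sum_(z in setT) F u v z
      = \sum_u \sum_v \sum_z F u v z.
    rewrite sum_setT; apply: eq_bigr => u _; rewrite sum_setT.
    by apply: eq_bigr => v _; rewrite sum_setT.
  by rewrite !expand.
Qed.

Local Open Scope classical_set_scope.

Theorem theorem3p5 (R : realType) (star : density_kind) :
  Lambda_pal R star `<=` Pi_infty R star.
Proof.
move=> _ [P <-]; exists (fun G => ~ colourable P G).
rewrite /turan_density; set S := (X in sup X).
have L_ub : ubound S (lagrangian R P star).
  move=> d [d01 dense]; apply: turan_upper d01 _ => eta n eta_gt0.
  have [H [le_n /family_free_colourable free den]] := dense eta n eta_gt0.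
  by exists H; split.
(* The Lagrangian is itself an admissible density, so the supremum is attained; its membership also
   supplies the nonemptiness that bounding the supremum requires. *)
have S_L : S (lagrangian R P star).
  split; first exact: lagrangian01.
  move=> eta n eta_gt0.
  have [H [le_n colH den]] := dense_palette_graph P star n eta_gt0.
  by exists H; split=> //; exact/family_free_colourable.
apply/eqP; rewrite eq_le; apply/andP; split.
  by apply: ge_sup => //; exists (lagrangian R P star).
by apply: ub_le_sup => //; exists (lagrangian R P star).
Qed.
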